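(* Let $\Omega\subset\mathbb{R}^n$, $n\geq 2$, be a bounded domain. Let $H_0$ be a fixed hermitean $N\times N$ matrix. Let $H\in C(\bar\Omega,\mathbb{C}^{N\times N})$ take values in hermitean matrices. Suppose that for every line $\gamma\colon[0,T]\to\bar\Omega$ with endpoints on $\partial\Omega$ the matrix $$e^{iTH_0}\,\mathrm{d}\exp_{-iTH_0}\left(i\int_0^TH(\gamma(t))\,dt\right)$$ is known up to an unknown multiple of the identity matrix. Then the trace free part of $H(x)$ is determined for every $x\in\Omega$. That is, if $H,\tilde H\in C(\bar\Omega,\mathbb{C}^{N\times N})$ are hermitean valued and for every such $\gamma$ the matrices above for $H$ and for $\tilde H$ differ by a scalar multiple of the identity, then $H(x)-\frac1N\operatorname{tr}(H(x))I=\tilde H(x)-\frac1N\operatorname{tr}(\tilde H(x))I$ for every $x\in\Omega$.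
   Context: Lines are unit speed line segments $\gamma(t)=x_0+tv$, $|v|=1$, $t\in[0,T]$, so $T$ is the length of $\gamma$. $\exp(A)=e^A=\sum_{k\ge0}A^k/k!$ is the matrix exponential, and $\mathrm{d}\exp_A$ denotes its derivative at the skew-hermitean matrix $A$, a linear map applied to a skew-hermitean matrix: $\mathrm{d}\exp_A(B)=\frac{d}{ds}e^{A+sB}|_{s=0}$. *)

(* Defs.v *)
From HB Require Import structures.
From mathcomp Require Import all_boot all_order all_algebra.
From mathcomp Require Import complex.
From mathcomp Require Import all_classical all_reals all_analysis.

Set Implicit Arguments.
Unset Strict Implicit.
Unset Printing Implicit Defensive.

Import Order.TTheory GRing.Theory Num.Theory.
Import numFieldNormedType.Exports.

Local Open Scope classical_set_scope.
Local Open Scope ring_scope.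
Local Open Scope complex_scope.

(* The libraries put no topology on [R[i]]: this is the one given by the
   modulus, and ['M[R[i]]_N] inherits the product (max norm) topology. *)
HB.instance Definition _ (R : rcfType) := NormedModule.copy R[i] R[i]^o.

(* The library norm on ['rV[R]_n] is the max norm: it is only used through its
   topology and bounded sets, which are those of the Euclidean norm. *)
Definition enorm (R : realType) (n : nat) (v : 'rV[R]_n) : R :=
  Num.sqrt (\sum_(k < n) v 0 k ^+ 2).

Definition boundary (X : topologicalType) (A : set X) : set X :=
  closure A `\` interior A.

Definition expmx (R : realType) (N : nat) (A : 'M[R[i]]_N) : 'M[R[i]]_N :=
  limn (series (fun k : nat => k`!%:R^-1 *: A ^+ k)).

(* The parameter s is real; the library ['D_B] on ['M[R[i]]_N] would use a
   complex one. *)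
Definition dexpmx (R : realType) (N : nat) (A B : 'M[R[i]]_N) : 'M[R[i]]_N :=
  lim ((fun s : R =>
          (s%:C)^-1 *: (expmx (A + s%:C *: B) - expmx A)) @ 0^').

Definition line (R : realType) (n : nat) (x0 v : 'rV[R]_n) (t : R) : 'rV[R]_n :=
  x0 + t *: v.

Definition boundary_line (R : realType) (n : nat) (Omega : set 'rV[R]_n)
    (x0 v : 'rV[R]_n) (T : R) : Prop :=
  [/\ enorm v = 1,
      0 < T,
      forall t, 0 <= t <= T -> closure Omega (line x0 v t),
      boundary Omega (line x0 v 0) &
      boundary Omega (line x0 v T)].

Definition line_integral (R : realType) (n N : nat)
    (H : 'rV[R]_n -> 'M[R[i]]_N) (x0 v : 'rV[R]_n) (T : R) : 'M[R[i]]_N :=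
  \matrix_(j < N, k < N)
    ((\int[lebesgue_measure]_(t in `[0, T]) complex.Re (H (line x0 v t) j k)) +i*
     (\int[lebesgue_measure]_(t in `[0, T]) complex.Im (H (line x0 v t) j k))).

Definition line_data (R : realType) (n N : nat) (H0 : 'M[R[i]]_N)
    (H : 'rV[R]_n -> 'M[R[i]]_N) (x0 v : 'rV[R]_n) (T : R) : 'M[R[i]]_N :=
  expmx (('i%C * T%:C) *: H0) *m
  dexpmx (- ('i%C * T%:C) *: H0) ('i%C *: line_integral H x0 v T).

Definition trace_free (R : realType) (N : nat) (A : 'M[R[i]]_N) : 'M[R[i]]_N :=
  A - (N%:R^-1 * \tr A)%:M.

(* Main.v *)
(** In an eigenbasis of [H0], with eigenvalues [lam j], the map
    [e^{-A} dexp_A] at [A = -i T H0] multiplies the [(j, l)] entry by a divided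
    difference of exponentials, which vanishes only if
    [T (lam j - lam l) \in 2 pi Z \ {0}]. Hence the data determine the integrals
    of the differences of diagonal entries over all chords, and those of an
    off-diagonal entry over all chords whose length avoids a discrete set.

    The exceptional chords are harmless. Replace [Omega] by the interior of its
    closure, which has fewer boundary points. Every end of a chord is then a
    limit of exterior points, and lines through exterior points close to the two
    ends contain chords close to the given one. These cannot all have the same
    length, so a chord is a limit of non-exceptional chords and its integral
    vanishes too.

    Extending the function by [0] outside the domain, all its line integrals in
    a two-dimensional plane vanish. By Fubini along lines of slope [b] its
    moments against [(x - b y)^k] vanish for all [b], hence all its moments
    vanish, and testing against peaking polynomials shows that it is [0]. *)

Require Import Defs.
From mathcomp Require Import all_boot all_order all_algebra.
From mathcomp Require Import complex.
From mathcomp Require Import all_classical all_reals all_analysis.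
From mathcomp Require Import measurable_realfun ring lra.

Set Implicit Arguments.
Unset Strict Implicit.
Unset Printing Implicit Defensive.

Import Order.TTheory GRing.Theory Num.Theory.
Import numFieldNormedType.Exports.
Import Normc.

Local Open Scope classical_set_scope.
Local Open Scope ring_scope.
Local Open Scope complex_scope.

(** * Matrix exponential and its derivative *)

(** No regularity of the boundary is assumed: [Omega] may be slit, a line may meet it in infinitely
    many intervals, and the extension by 0 is only bounded and measurable. Moments against
    polynomials ask for no more than that. Passing to the interior of the closure loses no data: a
    chord of it, with ends outside it, runs in [closure Omega] and ends on the boundary of [Omega].
    The gain is that both ends can be pushed into the open complement of [closure Omega], which is
    impossible at a slit. The ends of nearby chords are then under control, although the length of a
    chord need not depend continuously on the line. Moving a chord parallel to itself cannot be
    relied on to change its length, as two parallel faces show, so the perturbation has two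
    parameters, an offset [a] and a slope [b]. Lines in a plane are written [x = a + b * y]. One
    direction is missing, which is harmless: the moments are polynomials in the slope, and
    infinitely many slopes determine them. *)

Lemma series_dominated (R : realType) (a e : R^nat) :
  (forall k, `|a k| <= e k) -> cvgn (series e) -> cvgn (series a).
Proof.
move=> ae ce; apply: normed_cvg; apply: (series_le_cvg _ _ _ ce) => k //=.
exact: le_trans (normr_ge0 _) (ae k).
Qed.

Section l1_norm.
Context {R : realType} {N : nat}.
Notation C := R[i].
Implicit Types (A B M : 'M[C]_N).

(** Unlike the max norm behind the topology of matrices, the sum of the moduli of the entries is
    submultiplicative. It is real-valued, and [nbhs_l1norm] and [l1norm_nbhs] show that it gives the
    same neighbourhoods. *)
Definition l1norm A : R := \sum_j \sum_k normc (A j k).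

Lemma normc_ge0 (z : C) : 0 <= normc z.
Proof. by case: z => a b; exact: sqrtr_ge0. Qed.

Lemma ler_Re_normc (z : C) : `|complex.Re z| <= normc z.
Proof.
case: z => a b /=; rewrite -sqrtr_sqr ler_wsqrtr // lerDl; exact: sqr_ge0.
Qed.

Lemma ler_Im_normc (z : C) : `|complex.Im z| <= normc z.
Proof.
case: z => a b /=; rewrite -sqrtr_sqr ler_wsqrtr // lerDr; exact: sqr_ge0.
Qed.

Lemma normc_real (x : R) : normc x%:C = `|x|.
Proof. by rewrite /= expr0n addr0 sqrtr_sqr. Qed.

Lemma ler_normc_ReIm (z : C) : normc z <= `|complex.Re z| + `|complex.Im z|.
Proof.
rewrite {1}[z]complexE; apply: le_trans (le_normcD _ _) _.
have i1 : normc ('i%C : C) = 1 by rewrite /= expr0n add0r expr1n sqrtr1.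
by rewrite normcM i1 mul1r !normc_real.
Qed.

Lemma normr_normc (z : C) : `|z| = (normc z)%:C.
Proof. by rewrite normc_def; case: z. Qed.

Lemma l1norm_ge0 A : 0 <= l1norm A.
Proof. by apply: sumr_ge0 => j _; apply: sumr_ge0 => k _; exact: normc_ge0. Qed.

Lemma normc_le_l1norm A j k : normc (A j k) <= l1norm A.
Proof.
rewrite /l1norm (bigD1 j) //= (bigD1 k) //= -addrA lerDl addr_ge0 //.
  by apply: sumr_ge0 => ? _; exact: normc_ge0.
by apply: sumr_ge0 => ? _; apply: sumr_ge0 => ? _; exact: normc_ge0.
Qed.

Lemma l1norm0 : l1norm 0 = 0.
Proof. by rewrite /l1norm big1 // => j _; rewrite big1 // => k _; rewrite mxE normc0. Qed.

Lemma l1norm0_eq A : l1norm A = 0 -> A = 0.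
Proof.
move=> A0; apply/matrixP => j k; rewrite mxE; apply: eq0_normc.
by apply/eqP; rewrite eq_le normc_ge0 -A0 normc_le_l1norm.
Qed.

Lemma l1normD A B : l1norm (A + B) <= l1norm A + l1norm B.
Proof.
rewrite /l1norm -big_split; apply: ler_sum => j _.
rewrite -big_split; apply: ler_sum => k _; rewrite mxE; exact: le_normcD.
Qed.

Lemma l1normN A : l1norm (- A) = l1norm A.
Proof. by apply: eq_bigr => j _; apply: eq_bigr => k _; rewrite mxE normcN. Qed.

Lemma l1normB A B : l1norm (A - B) <= l1norm A + l1norm B.
Proof. by rewrite -(l1normN B); exact: l1normD. Qed.

Lemma l1normZ (c : C) A : l1norm (c *: A) = normc c * l1norm A.
Proof.
rewrite /l1norm mulr_sumr; apply: eq_bigr => j _.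
by rewrite mulr_sumr; apply: eq_bigr => k _; rewrite mxE normcM.
Qed.

Lemma l1normM A B : l1norm (A * B) <= l1norm A * l1norm B.
Proof.
have sum_le (I : finType) (F : I -> C) : normc (\sum_i F i) <= \sum_i normc (F i).
  elim/big_ind2 : _ => //; first by rewrite normc0.
  by move=> x a y b xa yb; apply: le_trans (le_normcD _ _) (lerD xa yb).
rewrite /l1norm mulr_suml; apply: ler_sum => j _.
apply: le_trans (_ : \sum_k \sum_m normc (A j m) * normc (B m k) <= _).
  apply: ler_sum => k _; rewrite mxE; apply: le_trans (sum_le _ _) _.
  by apply: ler_sum => m _; rewrite normcM.
rewrite exchange_big mulr_suml; apply: ler_sum => m _ /=.
rewrite -mulr_sumr ler_wpM2l ?normc_ge0 //.
rewrite [leRHS](bigD1 m) //= lerDl.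
by apply: sumr_ge0 => ? _; apply: sumr_ge0 => ? _; exact: normc_ge0.
Qed.

Lemma l1norm_sum (I : Type) (r : seq I) (F : I -> 'M[C]_N) :
  l1norm (\sum_(i <- r) F i) <= \sum_(i <- r) l1norm (F i).
Proof.
elim/big_ind2 : _ => //; first by rewrite l1norm0.
by move=> x a y b xa yb; apply: le_trans (l1normD _ _) (lerD xa yb).
Qed.

Lemma nbhs_l1norm M (S : set 'M[C]_N) : nbhs M S ->
  exists2 e : R, 0 < e & forall M', l1norm (M' - M) < e -> S M'.
Proof.
move=> [P nP PS].
have ball_at j k : exists e : R, 0 < e /\ forall z : C, normc (z - M j k) < e -> P j k z.
  have /nbhs_ballP[e /= e0 He] := nP j k.
  have eE : e = (complex.Re e)%:C by move: e0; rewrite ltcE => /andP[/eqP ei _]; case: (e) ei => a b /= ->.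
  exists (complex.Re e); split; first by move: e0; rewrite ltcE => /andP[].
  move=> z zM; apply: He; rewrite -ball_normE /=.
  by rewrite distrC normr_normc eE ltcR.
have [e He] := choice (fun jk : 'I_N * 'I_N => ball_at jk.1 jk.2).
have [e0 e00 e0le] : exists2 e0, 0 < e0 & forall jk, e0 <= e jk.
  exists (\big[Num.min/1]_jk e jk); last by move=> jk; exact: bigmin_le.
  by apply/bigmin_gtP; split => // jk _; have [] := He jk.
exists e0 => // M' MM'; apply: PS => j k.
have [_] := He (j, k); apply => /=.
apply: lt_le_trans (e0le (j, k)); apply: le_lt_trans MM'.
by have := normc_le_l1norm (M' - M) j k; rewrite !mxE.
Qed.

Lemma l1norm_nbhs M (e : R) : 0 < e -> \forall M' \near M, l1norm (M' - M) < e.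
Proof.
move=> e0; pose d := e / (N%:R ^+ 2 + 1).
have d0 : 0 < d by rewrite divr_gt0 // ltr_wpDl // sqr_ge0.
exists (fun j k => [set z : C | normc (z - M j k) < d]).
  move=> j k; apply/nbhs_ballP; exists d%:C => /=; first by rewrite ltcR.
  by move=> z; rewrite -ball_normE /= distrC normr_normc ltcR.
move=> M' MM'.
apply: le_lt_trans (_ : \sum_(j < N) \sum_(k < N) d < e).
  apply: ler_sum => j _; apply: ler_sum => k _; rewrite !mxE; apply: ltW; exact: MM'.
rewrite !sumr_const card_ord -mulrnA -mulr_natr natrM -expr2 /d mulrAC.
rewrite ltr_pdivrMr ?ltr_wpDl ?sqr_ge0 //.
by rewrite ltr_pM2l // ltrDl.
Qed.

Lemma cvg_l1norm (T : Type) (F : set_system T) (FF : Filter F) (f : T -> 'M[C]_N) M :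
  l1norm (f x - M) @[x --> F] --> (0 : R) -> f @ F --> M.
Proof.
move=> fM S /nbhs_l1norm[e e0 He].
apply: (filterS _ (cvgr_lt _ fM _ e0)); first by move=> x /He.
Qed.

Lemma mx_hausdorff : hausdorff_space 'M[C]_N.
Proof.
move=> A B cAB; apply/subr0_eq/l1norm0_eq/eqP; rewrite eq_le l1norm_ge0 andbT.
apply/ler_addgt0Pr => e e0; rewrite add0r.
have e2 : 0 < e / 2 by rewrite divr_gt0.
have [M [/= MA MB]] := cAB _ _ (l1norm_nbhs A e2) (l1norm_nbhs B e2).
have -> : A - B = (M - B) - (M - A) by rewrite opprB [RHS]addrC addrA subrK.
apply: le_trans (l1normB _ _) _; lra.
Qed.

Lemma lim_l1norm (T : Type) (F : set_system T) (FF : ProperFilter F) (f : T -> 'M[C]_N) M :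
  l1norm (f x - M) @[x --> F] --> (0 : R) -> lim (f @ F) = M.
Proof. by move=> fM; apply: cvg_lim; [exact: mx_hausdorff|exact: cvg_l1norm]. Qed.

(** The real and imaginary parts of every entry are dominated by [e], so only the completeness of
    the reals is used. *)
Lemma l1norm_complete (U : nat -> 'M[C]_N) (e : R ^nat) :
  (forall k, l1norm (U k) <= e k) -> cvgn (series e) ->
  exists M, l1norm (series U n - M) @[n --> \oo] --> (0 : R).
Proof.
move=> Ue ce.
have Uc m j k : normc (U m j k) <= e m := le_trans (normc_le_l1norm _ _ _) (Ue m).
have cvgRe j k : cvgn (series (fun m => complex.Re (U m j k))).
  by apply: (@series_dominated _ _ e) => // m; apply: le_trans (ler_Re_normc _) _.
have cvgIm j k : cvgn (series (fun m => complex.Im (U m j k))).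
  by apply: (@series_dominated _ _ e) => // m; apply: le_trans (ler_Im_normc _) _.
pose lRe j k := limn (series (fun m => complex.Re (U m j k))).
pose lIm j k := limn (series (fun m => complex.Im (U m j k))).
exists (\matrix_(j, k) (lRe j k +i* lIm j k)).
pose b n := \sum_j \sum_k (`|series (fun m => complex.Re (U m j k)) n - lRe j k| +
                          `|series (fun m => complex.Im (U m j k)) n - lIm j k|).
have b0 : b @ \oo --> (0 : R).
  have -> : (0 : R) = \sum_(j < N) \sum_(k < N) 0 by rewrite big1 // => j _; rewrite big1.
  apply: (@cvg_big _ _ _ _ _ _ _ \oo _ (fun j n => \sum_k (`|series (fun m => complex.Re (U m j k)) n - lRe j k| +
                          `|series (fun m => complex.Im (U m j k)) n - lIm j k|))) => [|j _].
    exact: add_continuous.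
  apply: (@cvg_big _ _ _ _ _ _ _ \oo _ (fun k n => `|series (fun m => complex.Re (U m j k)) n - lRe j k| +
                          `|series (fun m => complex.Im (U m j k)) n - lIm j k|)) => [|k _].
    exact: add_continuous.
  have cv0 (a : R^nat) l : a @ \oo --> l -> `|a n - l| @[n --> \oo] --> (0 : R).
    move=> al; rewrite -(normr0 R) -(subrr l).
    by apply: cvg_norm; apply: cvgB => //; exact: cvg_cst.
  by rewrite -[X in _ --> X]addr0; apply: cvgD; apply: cv0.
apply: (squeeze_cvgr _ (cvg_cst 0) b0).
near=> n; rewrite l1norm_ge0 /=; apply: ler_sum => j _; apply: ler_sum => k _.
apply: le_trans (ler_normc_ReIm _) _.
have partRe : complex.Re (series U n j k) = series (fun m => complex.Re (U m j k)) n.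
  rewrite /series /= summxE; elim/big_ind2 : _ => //.
  by move=> [? ?] ? [? ?] ? /= -> ->.
have partIm : complex.Im (series U n j k) = series (fun m => complex.Im (U m j k)) n.
  rewrite /series /= summxE; elim/big_ind2 : _ => //.
  by move=> [? ?] ? [? ?] ? /= -> ->.
rewrite !mxE -partRe -partIm.
by case: (series U n j k) => x y /=.
Unshelve. all: by end_near. Qed.
End l1_norm.

Lemma is_cvg_series_Zexp_coeff (R : realType) (K c : R) :
  cvgn (series (fun k => K * exp_coeff c k)).
Proof.
have -> : series (fun k => K * exp_coeff c k) = (fun n => K * series (exp_coeff c) n).
  by apply/funext => n; rewrite /series /= mulr_sumr.
by apply: is_cvgMr; exact: is_cvg_series_exp_coeff.
Qed.

Lemma add_thirds (R : realType) (y a b d z e : R) :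
  y <= z -> a <= e / 3 -> b <= e / 3 -> d <= e / 3 -> y + a + b + d <= z + e.
Proof. lra. Qed.

(** * Power series of the exponential and of its derivative *)

Section mexp.
Context {R : realType} {N : nat}.
Notation C := R[i].
Implicit Types (A B M : 'M[C]_N).

Lemma normc_invfact k : normc ((k`!%:R : C)^-1) = (k`!%:R : R)^-1.
Proof.
have -> : (k`!%:R : C) = (k`!%:R : R)%:C by rewrite rmorph_nat.
by rewrite normcV normc_real ger0_norm.
Qed.

Lemma mulmx_scaler (z : C) A B : A * (z *: B) = z *: (A * B).
Proof. by rewrite -[A * _]/(A *m _) -scalemxAr. Qed.

Lemma mulmx_scalel (z : C) A B : (z *: A) * B = z *: (A * B).
Proof. by rewrite -[_ * B]/(_ *m B) -scalemxAl. Qed.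

Lemma telescope_errors (a b d a' b' d' : 'M[C]_N) :
  a - b - d = (a' - b' - d') - (a' - a) + (b' - b) + (d' - d).
Proof. by apply/matrixP => i j; rewrite !mxE; ring. Qed.

Definition expterm A (k : nat) : 'M[C]_N := k`!%:R^-1 *: A ^+ k.

(** The [l1norm] of the identity is [N] and not 1, so bounds on powers carry this constant, which
    also has to cover the exponent 0. The summand 1 keeps it positive for [N = 0]. *)
Local Notation K := (1 + l1norm (1 : 'M[C]_N)).

Lemma l1norm1_gt0 : 0 < K.
Proof. by rewrite ltr_pwDl // l1norm_ge0. Qed.

Lemma l1normX A (c : R) k : l1norm A <= c -> l1norm (A ^+ k) <= K * c ^+ k.
Proof.
move=> Ac; have c0 : 0 <= c := le_trans (l1norm_ge0 _) Ac.
elim: k => [|k IH]; first by rewrite !expr0 mulr1 lerDr.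
rewrite exprSr [in leRHS]exprSr mulrA; apply: le_trans (l1normM _ _) _.
by apply: ler_pM; rewrite ?l1norm_ge0.
Qed.

Lemma expmx_series A : l1norm (series (expterm A) n - expmx A) @[n --> \oo] --> (0 : R).
Proof.
have [M HM] : exists M, l1norm (series (expterm A) n - M) @[n --> \oo] --> (0 : R).
  apply: (@l1norm_complete _ _ _ (fun k => K * exp_coeff (l1norm A) k)).
    move=> k; rewrite /expterm l1normZ normc_invfact mulrC.
    rewrite /exp_coeff /= mulrA ler_wpM2r ?invr_ge0 //.
    exact: l1normX.
  exact: is_cvg_series_Zexp_coeff.
by rewrite /expmx (lim_l1norm _ HM).
Qed.

(* The coefficient of [s] in [(A + s *: B) ^+ k]. *)
Fixpoint pow_deriv A B (k : nat) : 'M[C]_N :=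
  if k is k'.+1 then pow_deriv A B k' * A + A ^+ k' * B else 0.

Section expansion.
Variables (A B : 'M[C]_N).
Let c : R := l1norm A + l1norm B + 1.
Let Ac : l1norm A <= c. Proof. by rewrite /c -addrA lerDl addr_ge0 ?l1norm_ge0. Qed.
Let Bc : l1norm B <= c. Proof. by rewrite /c addrAC lerDr addr_ge0 ?l1norm_ge0. Qed.
Let c0 : 0 <= c. Proof. exact: le_trans (l1norm_ge0 _) Ac. Qed.

Let pert (s : R) := A + s%:C *: B.

Let pert_le s : `|s| <= 1 -> l1norm (pert s) <= c.
Proof.
move=> s1; apply: le_trans (l1normD _ _) _; rewrite /c -addrA lerD2l.
rewrite l1normZ normc_real; apply: le_trans (_ : l1norm B <= _); last by rewrite lerDl.
by rewrite -[leRHS]mul1r ler_wpM2r ?l1norm_ge0.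
Qed.

Lemma pow_deriv_bound k : l1norm (pow_deriv A B k) <= K * k%:R * c ^+ k.
Proof.
elim: k => [|k IH] /=; first by rewrite l1norm0 mulr0 mul0r.
apply: le_trans (l1normD _ _) _.
have -> : K * k.+1%:R * c ^+ k.+1 = K * k%:R * c ^+ k * c + K * c ^+ k * c.
  by rewrite exprSr -natr1; ring.
apply: lerD; apply: le_trans (l1normM _ _) _; apply: ler_pM; rewrite ?l1norm_ge0 //.
exact: l1normX.
Qed.

Lemma pow_diff_bound s k : `|s| <= 1 ->
  l1norm (pert s ^+ k - A ^+ k) <= `|s| * (K * k%:R * c ^+ k).
Proof.
move=> s1; elim: k => [|k IH]; first by rewrite !expr0 subrr l1norm0 mulr0 mul0r mulr0.
have -> : pert s ^+ k.+1 - A ^+ k.+1 = (pert s ^+ k - A ^+ k) * pert s + s%:C *: (A ^+ k * B).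
  rewrite !exprSr mulrBl /pert [A ^+ k * (A + _)]mulrDr mulmx_scaler.
  by rewrite opprD addrA subrK.
apply: le_trans (l1normD _ _) _.
have -> : `|s| * (K * k.+1%:R * c ^+ k.+1) =
    `|s| * (K * k%:R * c ^+ k) * c + `|s| * (K * c ^+ k * c).
  by rewrite exprSr -natr1; ring.
apply: lerD.
  apply: le_trans (l1normM _ _) _; apply: ler_pM; rewrite ?l1norm_ge0 //.
  exact: pert_le.
rewrite l1normZ normc_real ler_wpM2l //.
apply: le_trans (l1normM _ _) _; apply: ler_pM; rewrite ?l1norm_ge0 //.
exact: l1normX.
Qed.

(** The remainder at [k.+1] is the remainder at [k] times [A], plus [s] times the first-order error
    at [k] times [B]. By [pow_diff_bound] each step adds a multiple of [k], whence [k ^ 2] in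
    total. *)
Lemma pow_taylor_bound s k : `|s| <= 1 ->
  l1norm (pert s ^+ k - A ^+ k - s%:C *: pow_deriv A B k) <= s ^+ 2 * (K * k%:R ^+ 2 * c ^+ k).
Proof.
move=> s1; elim: k => [|k IH].
  by rewrite !expr0 subrr /= scaler0 subr0 l1norm0 expr0n /= mulr0 mul0r mulr0.
have -> : pert s ^+ k.+1 - A ^+ k.+1 - s%:C *: pow_deriv A B k.+1 =
    (pert s ^+ k - A ^+ k - s%:C *: pow_deriv A B k) * A + s%:C *: ((pert s ^+ k - A ^+ k) * B).
  rewrite !exprSr /= [in LHS]/pert mulrDr mulmx_scaler !mulrBl scalerBr scalerDr mulmx_scalel.
  by rewrite !opprD !addrA; rewrite [LHS](AC 5 (1*3*4*2*5))%AC.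
apply: le_trans (l1normD _ _) _.
apply: le_trans (_ : s ^+ 2 * (K * k%:R ^+ 2 * c ^+ k) * c +
    s ^+ 2 * (K * k%:R * c ^+ k) * c <= _); last first.
  rewrite -natr1 [c ^+ k.+1]exprSr.
  have -> : s ^+ 2 * (K * (k%:R + 1) ^+ 2 * (c ^+ k * c)) =
    s ^+ 2 * (K * k%:R ^+ 2 * c ^+ k) * c + s ^+ 2 * (K * k%:R * c ^+ k) * c
     + s ^+ 2 * K * (k%:R + 1) * (c ^+ k * c) by ring.
  rewrite lerDl; apply: mulr_ge0; last by rewrite mulr_ge0 ?exprn_ge0.
  by apply: mulr_ge0; [rewrite (mulr_ge0 (sqr_ge0 s) (ltW l1norm1_gt0))|rewrite addr_ge0].
apply: lerD.
  by apply: le_trans (l1normM _ _) _; apply: ler_pM; rewrite ?l1norm_ge0.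
rewrite l1normZ normc_real -real_normK ?num_real // expr2 -!mulrA ler_wpM2l //.
apply: le_trans (l1normM _ _) _; rewrite !mulrA; apply: ler_pM; rewrite ?l1norm_ge0 //.
rewrite -!mulrA [K * _]mulrA; exact: pow_diff_bound.
Qed.

(** Absorbs the factor [k ^ 2] of the Taylor bound into the base of the power, so that the
    exponential series at [4 * c] is a majorant. *)
Lemma sqr_natr_le_exp (k : nat) : (k%:R : R) ^+ 2 <= 4 ^+ k.
Proof.
rewrite -natrX -[4]/(4%:R) -natrX ler_nat.
have -> : 4%N = (2 ^ 2)%N by [].
by rewrite -expnM mulnC expnM leq_exp2r // ltnW // ltn_expl.
Qed.

Let S : R := limn (series (exp_coeff (4 * c))).

Let pow_deriv_cvg : exists X, l1norm (series (fun k => k`!%:R^-1 *: pow_deriv A B k) n - X) @[n --> \oo] --> (0 : R).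
Proof.
apply: (@l1norm_complete _ _ _ (fun k => K * exp_coeff (4 * c) k)); last first.
  exact: is_cvg_series_Zexp_coeff.
move=> k; rewrite l1normZ normc_invfact mulrC /exp_coeff /= mulrA.
rewrite ler_wpM2r ?invr_ge0 //; apply: le_trans (pow_deriv_bound k) _.
rewrite exprMn -mulrA ler_wpM2l ?(ltW l1norm1_gt0) // ler_wpM2r ?exprn_ge0 //.
apply: le_trans (sqr_natr_le_exp k).
rewrite -natrX ler_nat; case: (k) => // m.
by rewrite -[X in (X <= _)%N]expn1 leq_pexp2l.
Qed.

(** Summing the Taylor bounds gives a constant that depends neither on [s] nor on the truncation.
    The inequality passes to the limit at the cost of three truncation errors, each below
    [e / 3]. *)
Let taylor_bound s : `|s| <= 1 -> forall X,
  l1norm (series (fun k => k`!%:R^-1 *: pow_deriv A B k) n - X) @[n --> \oo] --> (0 : R) ->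
  l1norm (expmx (pert s) - expmx A - s%:C *: X) <= s ^+ 2 * (K * S).
Proof.
move=> s1 X HX.
apply/ler_addgt0Pr => e e0.
pose Y n := series (expterm (pert s)) n - series (expterm A) n -
  s%:C *: series (fun k => k`!%:R^-1 *: pow_deriv A B k) n.
have Yle n : l1norm (Y n) <= s ^+ 2 * (K * S).
  have -> : Y n = \sum_(0 <= k < n) k`!%:R^-1 *: (pert s ^+ k - A ^+ k - s%:C *: pow_deriv A B k).
    rewrite /Y /series /= scaler_sumr -!sumrB; apply: eq_bigr => k _.
    by rewrite !scalerBr !scalerA [s%:C * _]mulrC.
  apply: le_trans (l1norm_sum _ _) _.
  apply: le_trans (_ : \sum_(0 <= k < n) s ^+ 2 * (K * exp_coeff (4 * c) k) <= _).
    apply: ler_sum => k _; rewrite l1normZ normc_invfact mulrC /exp_coeff /= !mulrA.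
    rewrite ler_wpM2r ?invr_ge0 //; apply: le_trans (pow_taylor_bound k s1) _.
    rewrite -[leRHS]mulrA; apply: ler_wpM2l; first exact: sqr_ge0.
    rewrite -[leLHS]mulrA; apply: ler_wpM2l; first exact: ltW l1norm1_gt0.
    by rewrite exprMn ler_wpM2r ?exprn_ge0 // sqr_natr_le_exp.
  rewrite -!mulr_sumr; apply: (ler_wpM2l (sqr_ge0 s)); apply: (ler_wpM2l (ltW l1norm1_gt0)).
  apply: (nondecreasing_cvgn_le _ (is_cvg_series_exp_coeff (4 * c)) n).
  apply: nondecreasing_series => k _ _.
  by apply: exp_coeff_ge0; rewrite mulr_ge0.
have e4 : 0 < e / 3 by rewrite divr_gt0.
have small (u : R^nat) : u @ \oo --> (0 : R) -> \forall n \near \oo, u n < e / 3.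
  by move=> u0; exact: (cvgr_lt _ u0 _ e4).
have N1 := small _ (expmx_series (pert s)).
have N2 := small _ (expmx_series A).
have N3 := small _ HX.
have [n [n1 [n2 n3]]] := filter_ex (filterI N1 (filterI N2 N3)).
have -> : expmx (pert s) - expmx A - s%:C *: X = Y n -
    (series (expterm (pert s)) n - expmx (pert s)) + (series (expterm A) n - expmx A)
     + s%:C *: (series (fun k => k`!%:R^-1 *: pow_deriv A B k) n - X).
  by rewrite /Y scalerBr; exact: telescope_errors.
apply: le_trans (l1normD _ _) _; apply: le_trans (lerD (l1normD _ _) (lexx _)) _.
apply: le_trans (lerD (lerD (l1normB _ _) (lexx _)) (lexx _)) _.
apply: add_thirds (Yle n) (ltW n1) (ltW n2) _.
rewrite l1normZ normc_real -[leRHS]mul1r; apply: ler_pM => //; first exact: l1norm_ge0.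
exact: ltW.
Qed.

(** The exponential may be differentiated term by term: after division by [s] the quadratic
    remainder is still of order [|s|]. *)
Lemma dexpmx_series :
  l1norm (series (fun k => k`!%:R^-1 *: pow_deriv A B k) n - dexpmx A B) @[n --> \oo] --> (0 : R).
Proof.
have [X HX] := pow_deriv_cvg; suff -> : dexpmx A B = X by [].
apply: lim_l1norm.
have Kc : (fun s : R => `|s| * (K * S)) s @[s --> 0^'] --> (0 : R).
  rewrite -[X in _ --> X](mul0r (K * S)); apply: cvgM; last exact: cvg_cst.
  rewrite -[X in _ --> X](normr0 R); apply: cvg_norm.
  exact: cvg_within.
apply: (squeeze_cvgr _ (cvg_cst 0) Kc).
near=> s; rewrite l1norm_ge0 /=.
have s0 : s != 0 by near: s; exact: nbhs_dnbhs_neq.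
have s1 : `|s| <= 1.
  by near: s; apply: dnbhs0_le; exact: ltr01.
have -> : (s%:C)^-1 *: (expmx (A + s%:C *: B) - expmx A) - X =
   (s%:C)^-1 *: (expmx (pert s) - expmx A - s%:C *: X).
  rewrite [in RHS]scalerBr scalerA mulVf ?scale1r //.
  by apply: contra s0 => /eqP/complexI ->.
rewrite l1normZ normcV normc_real ler_pdivrMl ?normr_gt0 //.
apply: le_trans (taylor_bound s1 HX) _.
by rewrite [leRHS]mulrA -expr2 real_normK ?num_real.
Unshelve. all: by end_near. Qed.
End expansion.
End mexp.

(** * Line data in an eigenbasis of H0 *)

Section complex_limits.
Context {R : realType}.
Notation C := R[i].
Implicit Types (z w : nat -> C) (x y c : C).

Definition ccvg z x := normc (z n - x) @[n --> \oo] --> (0 : R).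

Lemma ccvg_dominated z x (b : R^nat) : (forall n, normc (z n - x) <= b n) ->
  b @ \oo --> (0 : R) -> ccvg z x.
Proof.
move=> zb b0; apply: (squeeze_cvgr _ (cvg_cst 0) b0).
by near=> n; rewrite normc_ge0 /=.
Unshelve. all: by end_near. Qed.

Lemma ccvgB z w x y : ccvg z x -> ccvg w y -> ccvg (fun n => z n - w n) (x - y).
Proof.
move=> zx wy; apply: (@ccvg_dominated _ _ (fun n => normc (z n - x) + normc (w n - y))).
  move=> n; have -> : z n - w n - (x - y) = (z n - x) + - (w n - y) by ring.
  by rewrite -(normcN (w n - y)); exact: le_normcD.
by rewrite -[X in _ --> X]addr0; exact: cvgD.
Qed.

Lemma ccvgM c z x : ccvg z x -> ccvg (fun n => c * z n) (c * x).
Proof.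
move=> zx; apply: (@ccvg_dominated _ _ (fun n => normc c * normc (z n - x))).
  by move=> n; rewrite -mulrBr normcM.
by rewrite -[X in _ --> X](mulr0 (normc c)); apply: cvgM; [exact: cvg_cst|].
Qed.

Lemma ccvg_shiftS z x : ccvg (fun n => z n.+1) x <-> ccvg z x.
Proof.
by rewrite /ccvg; have := cvg_shiftS (fun n => normc (z n - x)) (nbhs (0 : R)); rewrite /= => ->.
Qed.

Lemma ccvg_unique z x y : ccvg z x -> ccvg z y -> x = y.
Proof.
move=> zx zy; apply/subr0_eq/eq0_normc.
have := ccvgB zx zy; rewrite /ccvg; under eq_fun do rewrite subrr sub0r normcN.
by move=> H; apply: (cvg_unique (@Rhausdorff R) (cvg_cst _) H).
Qed.

Definition cis (t : R) : C := cos t +i* sin t.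

Lemma cis_series (t : R) : ccvg (series (fun k => k`!%:R^-1 * ('i%C * t%:C) ^+ k)) (cis t).
Proof.
(* The exponent [k.-1./2] is the one in [sin_coeff]; for odd [k] it equals [k./2]. *)
have i_pow k : ('i%C : C) ^+ k = ((~~ odd k)%:R * (-1) ^+ k./2) +i* ((odd k)%:R * (-1) ^+ k.-1./2).
  have m1 m : ((-1) ^+ m : C) = ((-1) ^+ m : R)%:C by rewrite rmorphXn rmorphN1.
  rewrite -{1}(odd_double_half k) exprD -mul2n exprM sqr_i m1.
  apply/eqP; rewrite eq_complex; have [ok|ek] := boolP (odd k).
    have -> : (k.-1)./2 = k./2 by rewrite -{1}(odd_double_half k) ok add1n /= doubleK.
    by rewrite /= ?expr1 /= ?mulr0 ?mulr1 ?mul0r ?mul1r ?subr0 ?addr0 ?add0r !eqxx.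
  by rewrite /= ?expr0 /= ?mulr0 ?mulr1 ?mul0r ?mul1r ?subr0 ?addr0 ?add0r !eqxx.
have term k : k`!%:R^-1 * ('i%C * t%:C) ^+ k = cos_coeff t k +i* sin_coeff t k.
  have inv : (k`!%:R^-1 : C) = (k`!%:R^-1 : R)%:C by rewrite fmorphV rmorph_nat.
  rewrite exprMn i_pow -rmorphXn inv /cos_coeff /sin_coeff /=.
  apply/eqP; rewrite eq_complex /= !mul0r !mulr0 !subr0 !addr0 ?add0r.
  by apply/andP; split; apply/eqP; rewrite mulrC.
have part n : series (fun k => k`!%:R^-1 * ('i%C * t%:C) ^+ k) n =
    series (cos_coeff t) n +i* series (sin_coeff t) n.
  rewrite /series /=; under eq_bigr do rewrite term.
  elim: n => [|n IH]; first by rewrite !big_nil.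
  by rewrite !big_nat_recr //= IH.
apply: (@ccvg_dominated _ _ (fun n => `|series (cos_coeff t) n - cos t| + `|series (sin_coeff t) n - sin t|)).
  by move=> n; rewrite part; apply: le_trans (ler_normc_ReIm _) _.
have cv0 (a : R^nat) l : a @ \oo --> l -> `|a n - l| @[n --> \oo] --> (0 : R).
  move=> al; rewrite -(normr0 R) -(subrr l).
  by apply: cvg_norm; apply: cvgB => //; exact: cvg_cst.
rewrite -[X in _ --> X]addr0; apply: cvgD; apply: cv0.
  by rewrite cos.unlock; exact: is_cvg_series_cos_coeff.
by rewrite sin.unlock; exact: is_cvg_series_sin_coeff.
Qed.
End complex_limits.

Section eigenbasis.
Context {R : realType} {N : nat}.
Notation C := R[i].
Variables (P : 'M[C]_N).
Hypothesis Pu : P \in unitmx.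
Implicit Types (A B X M : 'M[C]_N).

Definition conjm X : 'M[C]_N := P *m X *m invmx P.

Lemma conjmM X Y : conjm (X * Y) = conjm X *m conjm Y.
Proof. by rewrite /conjm !mulmxA mulmxKV. Qed.

Lemma conjmD X Y : conjm (X + Y) = conjm X + conjm Y.
Proof. by rewrite /conjm mulmxDr mulmxDl. Qed.

Lemma conjmB X Y : conjm (X - Y) = conjm X - conjm Y.
Proof. by rewrite /conjm mulmxBr mulmxBl. Qed.

Lemma conjmZ c X : conjm (c *: X) = c *: conjm X.
Proof. by rewrite /conjm -scalemxAr -scalemxAl. Qed.

Lemma conjm_scalar (c : C) : conjm c%:M = c%:M.
Proof. by rewrite /conjm mul_mx_scalar -scalemxAl mulmxV // scalemx1. Qed.

Lemma conjm_sum (I : Type) (r : seq I) (F : I -> 'M[C]_N) :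
  conjm (\sum_(i <- r) F i) = \sum_(i <- r) conjm (F i).
Proof.
elim/big_rec2 : _ => [|i x y _ <-]; first by rewrite /conjm mulmx0 mul0mx.
exact: conjmD.
Qed.

Lemma conjm_inj_scalar X (c : C) : conjm X = c%:M -> X = c%:M.
Proof.
move=> H; have -> : X = invmx P *m conjm X *m P.
  by rewrite /conjm !mulmxA mulVmx // mul1mx mulmxKV.
by rewrite H mul_mx_scalar -scalemxAl mulVmx // scalemx1.
Qed.

Lemma l1norm_conjm X : l1norm (conjm X) <= l1norm P * l1norm X * l1norm (invmx P).
Proof.
apply: le_trans (l1normM _ _) _; apply: ler_wpM2r; first exact: l1norm_ge0.
exact: l1normM.
Qed.

Lemma conjm_ccvg (U : nat -> 'M[C]_N) X j k :
  l1norm (U n - X) @[n --> \oo] --> (0 : R) ->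
  ccvg (fun n => conjm (U n) j k) (conjm X j k).
Proof.
move=> UX; pose b n := l1norm P * l1norm (U n - X) * l1norm (invmx P).
apply: (@ccvg_dominated _ _ _ b) => [n|].
  have := normc_le_l1norm (conjm (U n - X)) j k.
  by rewrite {1}conjmB !mxE => /le_trans; apply; exact: l1norm_conjm.
rewrite -[X in _ --> X](mul0r (l1norm (invmx P))).
apply: cvgM; last exact: cvg_cst.
by rewrite -[X in _ --> X](mulr0 (l1norm P)); apply: cvgM; [exact: cvg_cst|].
Qed.

(* [(x ^+ k - y ^+ k) / (x - y)], extended by continuity to [x = y]. *)
Fixpoint divdiff_pow (x y : C) (k : nat) : C :=
  if k is k'.+1 then divdiff_pow x y k' * y + x ^+ k' else 0.

Lemma divdiff_powE x y k : (x - y) * divdiff_pow x y k = x ^+ k - y ^+ k.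
Proof.
elim: k => [|k IH] /=; first by rewrite mulr0 !expr0 subrr.
by rewrite mulrDr mulrA IH !exprSr; ring.
Qed.

Lemma divdiff_pow_diag x k : divdiff_pow x x k.+1 = k.+1%:R * x ^+ k.
Proof.
elim: k => [|k IH]; first by rewrite /= mul0r add0r expr0 mulr1.
rewrite -[LHS]/(divdiff_pow x x k.+1 * x + x ^+ k.+1) IH -[k.+2%:R]natr1 exprSr; ring.
Qed.

Variables (A : 'M[C]_N) (tt : 'I_N -> R).
Let a j : C := 'i%C * (tt j)%:C.
Hypothesis Adiag : conjm A = diag_mx (\row_j a j).

Lemma conjm_pow k : conjm (A ^+ k) = diag_mx (\row_j a j ^+ k).
Proof.
elim: k => [|k IH].
  rewrite expr0 -[1]/(1%:M) conjm_scalar; apply/matrixP => i j; rewrite !mxE.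
  by rewrite expr0.
rewrite exprSr conjmM IH Adiag mulmx_diag; congr diag_mx.
by apply/rowP => j; rewrite !mxE exprSr.
Qed.

(** In a basis where [A] is diagonal the recursion of [pow_deriv] decouples into entries: right
    multiplication by [A] brings the eigenvalue of the column, the power on the left that of the
    row. This is the recursion of [divdiff_pow]. *)
Lemma conjm_pow_deriv B k j l :
  conjm (pow_deriv A B k) j l = divdiff_pow (a j) (a l) k * conjm B j l.
Proof.
elim: k => [|k IH] /=; first by rewrite /conjm mulmx0 mul0mx mxE mul0r.
rewrite conjmD !conjmM conjm_pow Adiag mul_diag_mx mul_mx_diag.
by move: (conjm (pow_deriv A B k)) (conjm B) IH => Y Z IH; rewrite !mxE IH; ring.
Qed.

Lemma conjm_expmx j l : conjm (expmx A) j l = cis (tt j) *+ (j == l).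
Proof.
apply: ccvg_unique (conjm_ccvg j l (expmx_series A)) _.
have E n : conjm (series (expterm A) n) j l =
    (j == l)%:R * series (fun k => k`!%:R^-1 * a j ^+ k) n.
  rewrite /series /= conjm_sum summxE mulr_sumr; apply: eq_bigr => k _.
  rewrite conjmZ conjm_pow !mxE; case: eqVneq => [->|_]; rewrite ?mulr1n ?mul1r //.
  by rewrite mulr0n mulr0 mul0r.
rewrite /ccvg; under eq_fun do rewrite E.
have -> : cis (tt j) *+ (j == l) = (j == l)%:R * cis (tt j) by rewrite mulr_natl.
exact: (ccvgM _ (cis_series (tt j))).
Qed.

(** Multiplying by [a j - a l] avoids divided differences of the exponential. For equal eigenvalues
    both sides vanish and [conjm_dexpmx_same] takes over. *)
Lemma conjm_dexpmx_diff B j l :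
  (a j - a l) * conjm (dexpmx A B) j l = conjm B j l * (cis (tt j) - cis (tt l)).
Proof.
apply: ccvg_unique (ccvgM (a j - a l) (conjm_ccvg j l (dexpmx_series A B))) _.
have E n : (a j - a l) * conjm (series (fun k => k`!%:R^-1 *: pow_deriv A B k) n) j l =
    conjm B j l * (series (fun k => k`!%:R^-1 * a j ^+ k) n - series (fun k => k`!%:R^-1 * a l ^+ k) n).
  rewrite /series /= conjm_sum summxE -sumrB !mulr_sumr; apply: eq_bigr => k _.
  rewrite conjmZ mxE conjm_pow_deriv mulrCA [_ * (_ * conjm B j l)]mulrA divdiff_powE; ring.
rewrite /ccvg; under eq_fun do rewrite E.
exact: (ccvgM _ (ccvgB (cis_series (tt j)) (cis_series (tt l)))).
Qed.

Lemma conjm_dexpmx_same B j l : tt j = tt l ->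
  conjm (dexpmx A B) j l = conjm B j l * cis (tt j).
Proof.
move=> jl; have al : a l = a j by rewrite /a jl.
apply: ccvg_unique (conjm_ccvg j l (dexpmx_series A B)) _.
(* The term of index 0 of the differentiated series is 0. After the shift, the factor [k.+1] from
   the divided difference turns the factorial of [k.+1] into that of [k]. *)
apply/ccvg_shiftS.
have E n : conjm (series (fun k => k`!%:R^-1 *: pow_deriv A B k) n.+1) j l =
    conjm B j l * series (fun k => k`!%:R^-1 * a j ^+ k) n.
  rewrite /series /= conjm_sum summxE big_nat_recl // conjmZ mxE conjm_pow_deriv mul0r mulr0 add0r.
  rewrite mulr_sumr; apply: eq_bigr => k _.
  rewrite conjmZ mxE conjm_pow_deriv al divdiff_pow_diag factS natrM invfM.
  have k0 : (k.+1%:R : C) != 0 by rewrite pnatr_eq0.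
  rewrite mulrA mulrC; congr (_ * _).
  by rewrite mulrACA mulVf // mul1r.
rewrite /ccvg; under eq_fun do rewrite E.
exact: (ccvgM _ (cis_series (tt j))).
Qed.
End eigenbasis.

Section line_data_entries.
Context {R : realType} {N : nat}.
Notation C := R[i].

Lemma cisM_N (t : R) : cis t * cis (- t) = 1.
Proof.
have := cos2Dsin2 t; rewrite /cis cosN sinN => cs.
apply/eqP; rewrite eq_complex /=; apply/andP; split; apply/eqP; last by ring.
by rewrite -cs !expr2; ring.
Qed.

Lemma cis_neq0 (t : R) : cis t != 0.
Proof.
by apply/eqP => c0; have := cisM_N t; rewrite c0 mul0r => /eqP; rewrite eq_sym oner_eq0.
Qed.

Lemma cis_eq_cos (s t : R) : cis s = cis t -> cos (s - t) = 1.
Proof.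
move=> [cc ss]; rewrite cosB cc ss -!expr2; exact: cos2Dsin2.
Qed.

Lemma hermitian_diagonalization (H0 : 'M[C]_N) : H0 \is hermsymmx ->
  exists (P : 'M[C]_N) (lam : 'I_N -> R), P \in unitmx /\
    conjm P H0 = diag_mx (\row_j (lam j)%:C).
Proof.
move=> Hh; have /orthomx_spectralP HE := hermitian_normalmx Hh.
have Pu := spectral_unit H0.
exists (spectralmx H0), (fun j => complex.Re (spectral_diag H0 0 j)); split => //.
rewrite /conjm {2}HE !mulmxA mulmxV // mul1mx mulmxK //; congr diag_mx.
apply/rowP => j; rewrite !mxE.
have /mxOverP/(_ 0 j) := hermitian_spectral_diag_real Hh.
by move/RRe_real.
Qed.

Lemma conjm_diag_mul (P E X1 X2 : 'M[C]_N) (e : 'I_N -> C) (c : C) :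
  P \in unitmx -> conjm P E = diag_mx (\row_j e j) ->
  E *m X1 - E *m X2 = c%:M ->
  forall j l, e j * (conjm P X1 j l - conjm P X2 j l) = c *+ (j == l).
Proof.
move=> Pu PE data j l.
have : diag_mx (\row_j e j) *m (conjm P X1 - conjm P X2) = c%:M.
  rewrite mulmxBr -PE -!(conjmM Pu) -conjmB.
  by rewrite -[RHS](conjm_scalar Pu c); exact: (congr1 (conjm P) data).
move: (conjm P X1) (conjm P X2) => Y1 Y2; rewrite mul_diag_mx => /matrixP/(_ j l).
by rewrite !mxE.
Qed.

(** In the eigenbasis the factor [expmx (i T H0)] is diagonal with nonzero entries
    [cis (T * lam j)]. Off the diagonal it can be cancelled; on the diagonal it is inverse to the
    factor [cis (- (T * lam j))] of the derivative. A scalar matrix is unchanged by conjugation, so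
    the unknown [c] enters only the diagonal entries, and all of them equally. *)
Lemma line_data_entries (H0 P B1 B2 : 'M[C]_N) (lam : 'I_N -> R) (T : R) (c : C) :
  P \in unitmx -> conjm P H0 = diag_mx (\row_j (lam j)%:C) ->
  expmx (('i%C * T%:C) *: H0) *m dexpmx (- ('i%C * T%:C) *: H0) ('i%C *: B1) -
  expmx (('i%C * T%:C) *: H0) *m dexpmx (- ('i%C * T%:C) *: H0) ('i%C *: B2) = c%:M ->
  (forall j l, j != l -> lam j = lam l \/ cos (T * (lam j - lam l)) != 1 ->
    conjm P (B1 - B2) j l = 0) /\
  (forall j l, conjm P (B1 - B2) j j = conjm P (B1 - B2) l l).
Proof.
move=> Pu PH; set E := expmx _; set A := - _ *: H0; move=> data.
have i0 : ('i%C : C) != 0 by rewrite eq_complex /= oner_eq0 andbF.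
have EE j l : conjm P E j l = cis (T * lam j) *+ (j == l).
  apply: (@conjm_expmx _ _ P Pu _ (fun j => T * lam j)).
  rewrite conjmZ PH; apply/matrixP => k m; rewrite !mxE rmorphM mulrA.
  by case: eqP => _; rewrite ?mulr1n ?mulr0n ?mulr0.
pose tt j := - (T * lam j).
have PA : conjm P A = diag_mx (\row_j ('i%C * (tt j)%:C)).
  rewrite conjmZ PH; apply/matrixP => k m; rewrite !mxE /tt rmorphN rmorphM.
  by case: eqP => _; rewrite ?mulr1n ?mulr0n ?mulr0 // mulrN mulNr mulrA.
pose D1 := conjm P (dexpmx A ('i%C *: B1)).
pose D2 := conjm P (dexpmx A ('i%C *: B2)).
have DE j l : cis (T * lam j) * (D1 j l - D2 j l) = c *+ (j == l).
  have PE : conjm P E = diag_mx (\row_j cis (T * lam j)).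
    by apply/matrixP => k m; rewrite EE !mxE; case: eqP => // ->.
  exact: (conjm_diag_mul Pu PE data j l).
have dB j l : conjm P (B1 - B2) j l = conjm P B1 j l - conjm P B2 j l.
  by rewrite conjmB !mxE.
have bZ X j l : conjm P ('i%C *: X) j l = 'i%C * conjm P X j l.
  by rewrite conjmZ !mxE.
have same1 j l : tt j = tt l -> D1 j l = 'i%C * conjm P B1 j l * cis (tt j).
  by move=> jl; rewrite -bZ; exact: (conjm_dexpmx_same Pu PA _ jl).
have same2 j l : tt j = tt l -> D2 j l = 'i%C * conjm P B2 j l * cis (tt j).
  by move=> jl; rewrite -bZ; exact: (conjm_dexpmx_same Pu PA _ jl).
have diff1 j l : ('i%C * (tt j)%:C - 'i%C * (tt l)%:C) * D1 j l =
    'i%C * conjm P B1 j l * (cis (tt j) - cis (tt l)).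
  by rewrite -bZ; exact: (conjm_dexpmx_diff Pu PA _ j l).
have diff2 j l : ('i%C * (tt j)%:C - 'i%C * (tt l)%:C) * D2 j l =
    'i%C * conjm P B2 j l * (cis (tt j) - cis (tt l)).
  by rewrite -bZ; exact: (conjm_dexpmx_diff Pu PA _ j l).
clearbody D1 D2.
have cB j l : conjm P (B1 - B2) j l = conjm P B1 j l - conjm P B2 j l := dB j l.
move: (conjm P (B1 - B2)) (conjm P B1) (conjm P B2) cB same1 same2 diff1 diff2.
move=> b b1 b2 bE same1 same2 diff1 diff2 {data dB bZ PA EE PH E A}.
split.
- move=> j l jl H; have D0 : D1 j l = D2 j l.
    apply/eqP; rewrite -subr_eq0; have := DE j l; rewrite (negPf jl) mulr0n => /eqP.
    by rewrite mulf_eq0 (negPf (cis_neq0 _)).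
  apply/eqP; rewrite bE subr_eq0; case: (eqVneq (lam j) (lam l)) H => [jlE _|jlE [/eqP|cosn]].
  + have tE : tt j = tt l by rewrite /tt jlE.
    move: D0; rewrite (same1 _ _ tE) (same2 _ _ tE) => /(mulIf (cis_neq0 _)).
    by move=> /(mulfI i0) ->.
  + by rewrite (negPf jlE).
  + have cn : cis (tt j) - cis (tt l) != 0.
      rewrite subr_eq0; apply: contra cosn => /eqP/cis_eq_cos.
      have -> : tt j - tt l = - (T * (lam j - lam l)) by rewrite /tt; ring.
      by rewrite cosN => ->.
    have := diff1 j l; rewrite D0 diff2 => /(mulIf cn)/(mulfI i0) ->.
    by [].
- suff diag j : 'i%C * b j j = c.
    by move=> j l; apply: (mulfI i0); rewrite !diag.
  have := DE j j; rewrite eqxx mulr1n (same1 j j erefl) (same2 j j erefl) -mulrBl mulrCA.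
  by rewrite /tt cisM_N mulr1 -mulrBr bE => <-.
Qed.
End line_data_entries.

(** * Chords of constant length *)

Lemma continuous_pair (X Y Z : topologicalType) (f : X -> Y) (g : X -> Z) :
  continuous f -> continuous g -> continuous (fun x => (f x, g x)).
Proof. by move=> cf cg x; exact: (cvg_pair (cf x) (cg x)). Qed.

Section first_exit.
Context {R : realType}.
Implicit Types (V : set R) (D : set (R * R)).

(* Junk value: [0] if [V] contains all nonnegative reals. *)
Definition first_exit V : R := inf [set y | 0 <= y /\ ~ V y].

Lemma first_exit_le V y : 0 <= y -> ~ V y -> first_exit V <= y.
Proof. by move=> y0 nV; apply: ge_inf => //; exists 0 => z []. Qed.

(** The infimum itself lies outside [V]: otherwise openness would keep all points slightly above it
    in [V], but points outside [V] come arbitrarily close to it from above. *)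
Lemma first_exitP V L : open V -> V 0 -> 0 <= L -> ~ V L ->
  [/\ 0 < first_exit V, ~ V (first_exit V) & forall y, 0 <= y < first_exit V -> V y].
Proof.
move=> oV V0 L0 nVL; set S := [set y | 0 <= y /\ ~ V y].
have S0 : S !=set0 by exists L.
have hS : has_inf S by split => //; exists 0 => z [].
have h0 : 0 <= first_exit V by apply: lb_le_inf => // z [].
have nVh : ~ V (first_exit V).
  move=> Vh; have /nbhs_ballP[e /= e0 He] := open_nbhs_nbhs (conj oV Vh).
  have : first_exit V < first_exit V + e by rewrite ltrDl.
  move=> /(inf_lt S0)[y [y0 nVy] ye]; apply: (nVy); apply: He.
  rewrite /ball/= ltr_distlC ye andbT.
  by apply: lt_le_trans (first_exit_le y0 nVy); rewrite ltrBlDr ltrDl.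
split => //.
  by rewrite lt_neqAle h0 andbT; apply/eqP => E; apply: nVh; rewrite -E.
move=> y /andP[y0 yh]; apply: contrapT => nVy.
by have := first_exit_le y0 nVy; rewrite leNgt yh.
Qed.

(** The tube lemma for the compact segment of heights [y]. *)
Lemma open_tube D a b y1 y2 : open D ->
  (forall y, y1 <= y <= y2 -> D (a + b * y, y)) ->
  \forall a' \near a, forall y, y1 <= y <= y2 -> D (a' + b * y, y).
Proof.
move=> oD Da.
have /compact_near_coveringP cpt := @segment_compact R y1 y2.
have H := cpt _ (nbhs a) (fun a' y => D (a' + b * y, y)) (nbhs_filter a).
apply: filterS (H _) => [a' Ha' y yy|x].
  by apply: Ha'; rewrite /= in_itv.
rewrite /= in_itv/= => /Da Dx.
have ct : continuous (fun z : R * R => (z.2 + b * z.1, z.1)).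
  apply: continuous_pair => z; last exact: cvg_fst.
  apply: cvgD; first exact: cvg_snd.
  by apply: cvgM; [exact: cvg_cst|exact: cvg_fst].
by have := ct (x, a) _ (open_nbhs_nbhs (conj oD Dx)).
Qed.
End first_exit.

Section beam.
Context {R : realType}.
Variables (D : set (R * R)) (L alpha : R).
Hypotheses (oD : open D) (L0 : 0 < L) (alpha0 : 0 < alpha).
Hypothesis ends_out : forall a, `|a| <= alpha -> ~ D (a, L) /\ ~ D (a, - L).
Hypothesis mid_in : forall a, `|a| <= alpha -> D (a, 0).

(** [yar] is the reflected ray, so that the lower end is a first exit too. [up] and [dn] are
    ordinates: the Euclidean length of the chord is [up - dn] times [Num.sqrt (1 + b ^+ 2)]. *)
Let ray (a b : R) : set R := [set y | D (a + b * y, y)].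
Let yar (a b : R) : set R := [set y | D (a - b * y, - y)].
Let up a b : R := first_exit (ray a b).
Let dn a b : R := - first_exit (yar a b).

Let open_ray a b : open (ray a b).
Proof.
have cl : continuous (fun y : R => (a + b * y, y)).
  apply: continuous_pair => y; last exact: cvg_id.
  by apply: cvgD; [exact: cvg_cst|apply: cvgM; [exact: cvg_cst|exact: cvg_id]].
exact: ((continuousP _).1 cl D oD).
Qed.

Let open_yar a b : open (yar a b).
Proof.
have cl : continuous (fun y : R => (a - b * y, - y)).
  apply: continuous_pair => y; last exact: continuousN.
  by apply: cvgB; [exact: cvg_cst|apply: cvgM; [exact: cvg_cst|exact: cvg_id]].
exact: ((continuousP _).1 cl D oD).
Qed.

Let adm (a b : R) : bool := `|a| + `|b| * L <= alpha.

Let adm_bounds a b y : adm a b -> `|y| <= L -> `|a + b * y| <= alpha.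
Proof.
move=> ab yL; apply: le_trans (ler_normD _ _) _; apply: le_trans ab.
by rewrite lerD2l normrM ler_wpM2l.
Qed.

Let upP a b : adm a b ->
  [/\ 0 < up a b, up a b <= L, ~ D (a + b * up a b, up a b) &
      forall y, 0 <= y < up a b -> D (a + b * y, y)].
Proof.
move=> ab.
have nL : ~ ray a b L.
  by have [] := @ends_out (a + b * L) (adm_bounds ab _); rewrite ?gtr0_norm.
have r0 : ray a b 0.
  by rewrite /ray/= mulr0 addr0; apply: mid_in; have := @adm_bounds a b 0 ab; rewrite mulr0 addr0 normr0; apply; exact: ltW.
have [h0 nh yh] := first_exitP (@open_ray a b) r0 (ltW L0) nL.
by split => //; apply: first_exit_le nL; exact: ltW.
Qed.

Let dnP a b : adm a b ->
  [/\ dn a b < 0, - L <= dn a b, ~ D (a + b * dn a b, dn a b) &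
      forall y, dn a b < y <= 0 -> D (a + b * y, y)].
Proof.
move=> ab.
have nL : ~ yar a b L.
  have NL : `|- L| <= L by rewrite normrN gtr0_norm.
  by have [_] := ends_out (adm_bounds ab NL); rewrite mulrN.
have r0 : yar a b 0.
  by rewrite /yar/= mulr0 subr0 oppr0; apply: mid_in; have := @adm_bounds a b 0 ab; rewrite mulr0 addr0 normr0; apply; exact: ltW.
have [h0 nh yh] := first_exitP (@open_yar a b) r0 (ltW L0) nL.
split; first by rewrite oppr_lt0.
- by rewrite lerN2; apply: first_exit_le nL; exact: ltW.
- by rewrite mulrN.
- move=> y /andP[y1 y2]; have := yh (- y); rewrite /yar/= mulrN !opprK; apply.
  by rewrite oppr_ge0 y2 ltrNl.
Qed.

Let up_le a b y : 0 <= y -> ~ D (a + b * y, y) -> up a b <= y.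
Proof. exact: first_exit_le. Qed.

Let dn_ge a b y : y <= 0 -> ~ D (a + b * y, y) -> y <= dn a b.
Proof.
move=> y0 nD; rewrite lerNr; apply: first_exit_le; rewrite ?oppr_ge0//.
by rewrite /yar/= mulrN !opprK.
Qed.

(* Suppose all chords had length [T0], and let [dn a b < 0 < up a b] be the ends
   of the chord of slope [b] through [(a, 0)]. The ends of a chord lie outside
   [D], so they bound the vertical chords through them; comparing a chord of
   slope [b], whose vertical extent [g b] is shorter than [T0], with the two
   vertical chords through its ends gives
   [dn (a + b * g b) 0 < dn a 0]. Slopes [b] and [- b] contradict each other.
   That a chord of slope [b] ends above every given [a] follows from the
   intermediate value theorem: [dn] is upper semicontinuous and
   [up = dn + g b] is lower semicontinuous, so [dn] is continuous. *)
Lemma beam_chord_neq (T0 : R) : exists a b w u : R,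
  [/\ `|a| + `|b| * L <= alpha, - L <= w < 0 /\ 0 < u <= L,
      ~ D (a + b * w, w) /\ ~ D (a + b * u, u),
      forall y, w < y < u -> D (a + b * y, y) &
      (u - w) * Num.sqrt (1 + b ^+ 2) != T0].
Proof.
apply: contrapT => noex.
have len a b : adm a b -> (up a b - dn a b) * Num.sqrt (1 + b ^+ 2) = T0.
  move=> ab; apply/eqP; apply: contrapT => /negP neq; apply: noex.
  exists a, b, (dn a b), (up a b).
  have [u0 uL nu hu] := upP ab; have [w0 wL nw hw] := dnP ab.
  split=> //; first by rewrite w0 wL u0 uL.
  move=> y /andP[wy yu]; have [y0|y0] := leP y 0; first by apply: hw; rewrite wy.
  by apply: hu; rewrite (ltW y0).
pose g b : R := T0 / Num.sqrt (1 + b ^+ 2).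
have sq0 b : 0 < Num.sqrt (1 + b ^+ 2) :> R.
  by rewrite sqrtr_gt0 ltr_wpDr ?sqr_ge0.
have upE a b : adm a b -> up a b = dn a b + g b.
  by rewrite /g => /len <-; rewrite mulfK ?gt_eqF // addrC subrK.
have cont_dn a b : `|a| + `|b| * L < alpha -> {for a, continuous (dn^~ b)}.
  move=> ab; have adma : adm a b := ltW ab.
  have [u0 uL nu hu] := upP adma; have [w0 wL nw hw] := dnP adma.
  have near_adm : \forall a' \near a, adm a' b.
    have : \forall a' \near a, `|a'| < alpha - `|b| * L.
      by apply: (@cvgr_norm_lt _ _ _ (nbhs a) _ id a); [exact: cvg_id|rewrite ltrBrDr].
    by apply: filterS => a'; rewrite /adm ltrBrDr => /ltW.
  apply/cvgrPdist_lt => /= e e0.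
  have t1 : \forall a' \near a, forall y, 0 <= y <= up a b - e / 2 -> D (a' + b * y, y).
    apply: open_tube => // y /andP[y1 y2]; apply: hu; rewrite y1; lra.
  have t2 : \forall a' \near a, forall y, dn a b + e / 2 <= y <= 0 -> D (a' + b * y, y).
    apply: open_tube => // y /andP[y1 y2]; apply: hw; rewrite y2; lra.
  near=> a'.
  have adm' : adm a' b by near: a'.
  have [u0' uL' nu' hu'] := upP adm'; have [w0' wL' nw' hw'] := dnP adm'.
  have T1 : forall y, 0 <= y <= up a b - e / 2 -> D (a' + b * y, y) by near: a'.
  have T2 : forall y, dn a b + e / 2 <= y <= 0 -> D (a' + b * y, y) by near: a'.
  have ub : up a b - e / 2 < up a' b.
    by rewrite ltNge; apply/negP => le; apply: nu'; apply: T1; rewrite (ltW u0').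
  have lb : dn a' b < dn a b + e / 2.
    by rewrite ltNge; apply/negP => le; apply: nw'; apply: T2; rewrite (ltW w0') andbT.
  move: ub; rewrite !upE // => ub.
  rewrite ltr_distlC; lra.
(* The factor 2 in the first condition: the offset [a] found below differs from [a1] by up to
   [|b| * L], and the line of slope [b] with that offset needs the same margin again to be
   admissible. *)
have shift b a1 : `|a1| + 2 * (`|b| * L) < alpha -> `|a1| + `|b * g b| <= alpha ->
    dn (a1 + b * g b) 0 <= dn a1 0 - (T0 - g b).
  move=> h1 h2.
  have bL0 : 0 <= `|b| * L by rewrite mulr_ge0 // ltW.
  have admx x : `|x - a1| <= `|b| * L -> `|x| + `|b| * L < alpha.
    move=> xa; apply: le_lt_trans h1; rewrite mulr_natl mulr2n addrA lerD2r.
    by have := ler_normD (x - a1) a1; rewrite subrK; lra.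
  have adm1 : adm a1 0 by rewrite /adm normr0 mul0r addr0; lra.
  have adm2 : adm (a1 + b * g b) 0.
    by rewrite /adm normr0 mul0r addr0; apply: le_trans (ler_normD _ _) _.
  (* [f a] is the abscissa of the lower end of the chord of slope [b] through [(a, 0)]. Once it
     equals [a1], the upper end has abscissa [a1 + b * g b]. *)
  pose f a := a + b * dn a b.
  have bdn a : `|a - a1| <= `|b| * L -> `|b * dn a b| <= `|b| * L.
    move=> /admx /ltW /dnP [w0 wL _ _].
    by rewrite normrM ler_wpM2l // ltr0_norm //; lra.
  have lohi : a1 - `|b| * L <= a1 + `|b| * L by lra.
  have [a ain fa] : exists2 a, a \in `[a1 - `|b| * L, a1 + `|b| * L] & f a = a1.
    apply: IVT => //.
      apply: continuous_in_subspaceT => x; rewrite inE /= in_itv/= => xin.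
      have xa : `|x - a1| <= `|b| * L by rewrite ler_distlC; lra.
      apply: cvgD; first exact: cvg_id.
      by apply: cvgM; [exact: cvg_cst|exact: cont_dn (admx x xa)].
    rewrite ge_min le_max; apply/andP; split; apply/orP; [left|right].
      have := bdn (a1 - `|b| * L); rewrite addrAC subrr sub0r normrN ger0_norm // => /(_ (lexx _)).
      by rewrite /f ler_norml; lra.
    have := bdn (a1 + `|b| * L); rewrite addrAC subrr add0r ger0_norm // => /(_ (lexx _)).
    by rewrite /f ler_norml; lra.
  have xa : `|a - a1| <= `|b| * L by move: ain; rewrite in_itv/= ler_distlC; lra.
  have adma : adm a b := ltW (admx a xa).
  have [w0 wL nw _] := dnP adma; have [u0 uL nu _] := upP adma.
  have low : dn a b <= dn a1 0.
    by apply: dn_ge; [exact: ltW|rewrite mul0r addr0 -{1}fa].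
  have high : up (a1 + b * g b) 0 <= up a b.
    apply: up_le; first exact: ltW.
    rewrite mul0r addr0 -[X in D (X + _, _)]fa /f -addrA -mulrDr -upE //.
  have g0 : g 0 = T0 by rewrite /g expr0n addr0 sqrtr1 divr1.
  move: high; rewrite !upE // g0; lra.
(* With this slope [|b| * L] is [alpha / 8], and [T0 <= 2 * L] gives [|b * g b| <= alpha / 4]. Both
   applications of [shift] therefore stay within [alpha]. *)
pose b := alpha / (8 * L).
have bp : 0 < b by rewrite divr_gt0 // mulr_gt0.
have bL : `|b| * L = alpha / 8 by rewrite gtr0_norm // /b; field; rewrite gt_eqF.
have adm0 : adm 0 0 by rewrite /adm !normr0 mul0r addr0 ltW.
have [w0 wL _ _] := dnP adm0; have [u0 uL _ _] := upP adm0.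
have T0E : T0 = up 0 0 - dn 0 0 by rewrite -(len 0 0 adm0) expr0n addr0 sqrtr1 mulr1.
have T00 : 0 < T0 by rewrite T0E; lra.
have T0L : T0 <= 2 * L by rewrite T0E; lra.
have sq1 : 1 < Num.sqrt (1 + b ^+ 2).
  by rewrite -[ltLHS]sqrtr1 ltr_sqrt ?ltrDl ?exprn_gt0 // ltr_wpDr ?sqr_ge0.
have gT : g b < T0 by rewrite /g ltr_pdivrMr // ltr_pMr.
have gp : 0 < g b by rewrite /g divr_gt0.
have bg : `|b * g b| <= alpha / 4.
  rewrite normrM (gtr0_norm gp); apply: le_trans (_ : `|b| * (2 * L) <= _).
    by rewrite ler_wpM2l //; lra.
  by rewrite mulrCA bL; lra.
have gN : g (- b) = g b by rewrite /g sqrrN.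
(* Going to the offset [b * g b] and back would lower [dn 0 0] by twice the positive number
   [T0 - g b]. *)
have s1 : dn (b * g b) 0 <= dn 0 0 - (T0 - g b).
  have := @shift b 0; rewrite normr0 !add0r bL; apply; move: bg (alpha0); lra.
have s2 : dn 0 0 <= dn (b * g b) 0 - (T0 - g b).
  have := @shift (- b) (b * g b); rewrite gN mulNr subrr !normrN bL.
  by apply; move: bg (alpha0); lra.
lra.
Unshelve. all: by end_near. Qed.
End beam.

(** * Vanishing line integrals in the plane *)

Section plane_measure.
Context {R : realType}.
Implicit Types (U : set (R * R)).

(** An open set is the union of the rational boxes contained in it; [V] makes the other boxes empty,
    so that the index set is visibly countable. *)
Lemma open_measurable_prod U : open U ->
  measurable (U : set (measurableTypeR R * measurableTypeR R)%type).
Proof.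
move=> oU.
pose I (p q : rat) : set R := `]ratr p, ratr q[%classic.
pose V (k : (rat * rat) * (rat * rat)) : set (R * R) :=
  if pselect (I k.1.1 k.1.2 `*` I k.2.1 k.2.2 `<=` U)
  then I k.1.1 k.1.2 `*` I k.2.1 k.2.2 else set0.
have -> : U = \bigcup_k V k.
  apply/seteqP; split => [[x y] Uxy|z [k _]]; last first.
    by rewrite /V; case: pselect => //= sub; exact: sub.
  have [[A B] /= [Ax By] ABU] : nbhs (x, y) U by apply: open_nbhs_nbhs.
  have itv (t : R) (C : set R) : nbhs t C ->
      exists p q : rat, I p q t /\ I p q `<=` C.
    move=> /nbhs_ballP[e /= e0 eC].
    have /rat_in_itvoo[p] : t - e < t by rewrite ltrBlDr ltrDl.
    rewrite in_itv/= => /andP[p1 p2].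
    have /rat_in_itvoo[q] : t < t + e by rewrite ltrDl.
    rewrite in_itv/= => /andP[q1 q2].
    exists p, q; split; first by rewrite /I/= in_itv/= p2 q1.
    move=> s; rewrite /I/= in_itv/= => /andP[s1 s2]; apply: eC.
    rewrite /ball/= ltr_distlC (lt_trans p1 s1)/=.
    exact: lt_trans s2 _.
  have [p [q [pqx pqA]]] := itv _ _ Ax.
  have [p' [q' [pqy pqB]]] := itv _ _ By.
  exists ((p, q), (p', q')) => //; rewrite /V /=.
  case: pselect => [?|H] /=; first by split.
  exfalso; apply: H => -[s t] [/= Is It]; apply: ABU; split => /=; [exact: pqA|exact: pqB].
apply: countable_bigcupT_measurable; first exact: countableP.
move=> k; rewrite /V; case: pselect => ? /=; last exact: measurable0.
by apply: measurableX; exact: measurable_itv.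
Qed.

Lemma continuous_measurable_prod (h : R * R -> R) : continuous h ->
  measurable_fun setT (h : measurableTypeR R * measurableTypeR R -> measurableTypeR R).
Proof.
move=> ch; apply: (measurability _ (RGenOpens.measurableE R)).
move=> _ [_ [a [b ->] <-]]; rewrite setTI; apply: open_measurable_prod.
by move/continuousP : ch; apply; exact: interval_open.
Qed.

Notation mu := (@lebesgue_measure R).


(** The image of Lebesgue measure under a translation agrees with it on half-open intervals, hence
    on all measurable sets by uniqueness. *)
Lemma integral_shift (g : R -> R) (c : R) : measurable_fun setT g ->
  mu.-integrable setT (EFin \o g) ->
  (\int[mu]_x (g (x + c)%R)%:E = \int[mu]_x (g x)%:E)%E.
Proof.
move=> mg ig.
have mc (d : R) : measurable_fun setT (fun x : measurableTypeR R => x + d : measurableTypeR R).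
  by apply: measurable_funD => //; exact: measurable_cst.
have muE (d : R) A : measurable A ->
    mu A = pushforward mu (fun x : measurableTypeR R => x + d : measurableTypeR R) A.
  apply: (@lebesgue_measure_unique R (pushforward mu (fun x : measurableTypeR R => x + d : measurableTypeR R))).
  move=> _ [[a b] _ <-].
  change (mu `]a, b]%classic = mu ((fun x : R => x + d) @^-1` `]a, b]%classic)).
  rewrite [X in _ = lebesgue_measure X](_ : _ = `]a - d, b - d]%classic); last first.
    by apply/seteqP; split => x /=; rewrite !in_itv/= ltrBlDr lerBrDr.
  rewrite !lebesgue_measure_itv/= !lte_fin ltrD2r.
  by case: ifPn => // ab; congr (_%:E); ring.
pose sh (x : measurableTypeR R) : measurableTypeR R := x + c.
have msh : measurable_fun setT sh by exact: mc.
transitivity (\int[pushforward mu sh]_x (g x)%:E)%E; last first.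
  by apply: eq_measure_integral => A mA _; apply: esym; apply: (muE c A).
rewrite integral_pushforward //; first by apply/measurable_EFinP.
rewrite preimage_setT.
apply/integrableP; split.
  apply/measurable_EFinP.
  exact: (measurableT_comp mg msh).
have [_ fin_g] := integrableP _ _ _ ig.
have mabs : measurable_fun setT (fun x => `|(EFin \o g) x|%E).
  by apply: measurableT_comp => //; exact/measurable_EFinP.
have : (\int[pushforward mu sh]_x `|(EFin \o g) x| < +oo)%E.
  rewrite (@eq_measure_integral _ _ _ _ mu) // => A mA _.
  by apply: esym; apply: (muE c A).
by rewrite ge0_integral_pushforward.
Qed.

Lemma integrable_box (W : R * R -> R) (B M : R) :
  measurable_fun setT (W : measurableTypeR R * measurableTypeR R -> measurableTypeR R) ->
  (forall z, `|W z| <= B) ->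
  (forall z, W z != 0 -> `|z.1| <= M /\ `|z.2| <= M) ->
  (mu \x mu)%E.-integrable setT (EFin \o W).
Proof.
move=> mW WB Wsupp.
pose D := (`[- M, M]%classic `*` `[- M, M]%classic) : set (measurableTypeR R * measurableTypeR R).
have mD : measurable D by apply: measurableX; exact: measurable_itv.
have -> : EFin \o W = (EFin \o W) \_ D.
  apply/funext => z; rewrite patchE; case: ifPn => // /negP zD /=.
  congr (_%:E); apply/eqP; apply: contrapT => /negP/Wsupp[z1 z2].
  by apply: zD; rewrite inE; split; rewrite /= in_itv/= -ler_norml.
have [+ _] := @integrable_mkcond _ _ _ (mu \x mu)%E D (EFin \o W) mD; apply.
apply: measurable_bounded_integrable => //.
- rewrite [ltLHS](_ : _ = (mu `[(- M)%R, M]%classic * mu `[(- M)%R, M]%classic)%E); last first.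
    by apply: product_measure1E; exact: measurable_itv.
  by rewrite lebesgue_measure_itv/=; case: ifPn => _; rewrite ?mule0 ?ltry// -EFinM ltry.
- exact: measurable_funTS.
- exists B; split; first by rewrite num_real.
  by move=> x xB z _ /=; exact: le_trans (WB z) (ltW xB).
Qed.

Lemma integrable_segment (g : R -> R) (B M : R) : measurable_fun setT g ->
  (forall x, `|g x| <= B) -> (forall x, g x != 0 -> `|x| <= M) ->
  mu.-integrable setT (EFin \o g).
Proof.
move=> mg gB gsupp.
have -> : EFin \o g = (EFin \o g) \_ `[- M, M]%classic.
  apply/funext => x; rewrite patchE; case: ifPn => // /negP xD /=.
  congr (_%:E); apply/eqP; apply: contrapT => /negP/gsupp xM.
  by apply: xD; rewrite inE /= in_itv/= -ler_norml.
have [+ _] := @integrable_mkcond _ _ _ mu `[- M, M]%classic (EFin \o g) (measurable_itv _); apply.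
apply: measurable_bounded_integrable => //.
- by rewrite [ltLHS](lebesgue_measure_itv `[- M, M])/=; case: ifPn => _; rewrite ?ltry// -EFinD ltry.
- exact: measurable_funTS.
- exists B; split; first by rewrite num_real.
  by move=> x xB z _ /=; exact: le_trans (gB z) (ltW xB).
Qed.

(** The trace of the domain on a line is a countable disjoint union of open intervals. Each is a
    chord, since its ends lie outside [U], so the vanishing over chords adds up to the whole
    line. *)
Lemma integral_open_components (U : set R) (k : R -> R) (M : R) :
  open U -> U `<=` `[- M, M]%classic -> continuous k ->
  (forall c d, c < d -> (forall y, c < y < d -> U y) -> ~ U c -> ~ U d ->
    \int[mu]_(y in `[c, d]) k y = 0) ->
  (\int[mu]_(y in U) (k y)%:E = 0)%E.
Proof.
move=> oU UM ck H.
have [I [oiI tI UI]] := OpenSetDisjointItvs.open_disjoint_itv oU.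
have kI (c d : R) : mu.-integrable `[c, d]%classic (EFin \o k).
  apply: continuous_compact_integrable; first exact: segment_compact.
  exact: continuous_subspaceT.
rewrite UI integral_bigcup//; last 2 first.
- by move=> n; apply: open_measurable; have [] := oiI n.
- rewrite -UI; apply: integrableS (kI (- M) M) => //; exact: open_measurable.
apply: eseries0 => n _ _.
have [oI iI] := oiI n.
have [->|/set0P[z Iz]] := eqVneq (I n) set0; first by rewrite integral_set0.
have IU : I n `<=` U by rewrite UI; exact: bigcup_sup.
have IM x : I n x -> - M <= x <= M by move/IU/UM; rewrite /= in_itv.
have hl : has_lbound (I n) by exists (- M) => x /IM /andP[].
have hu : has_ubound (I n) by exists M => x /IM /andP[].
have hi : has_inf (I n) by split => //; exists z.
have hs : has_sup (I n) by split => //; exists z.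
set c := inf (I n); set d := sup (I n).
have ball_in x : I n x -> exists2 e, 0 < e & forall y, `|x - y| < e -> I n y.
  by move=> Ix; have /nbhs_ballP[e /= e0 H'] := open_nbhs_nbhs (conj oI Ix); exists e.
have cI : ~ I n c.
  move=> /ball_in[e e0 He].
  have : I n (c - e / 2).
    by apply: He; rewrite opprB addrC subrK gtr0_norm ?divr_gt0//; lra.
  by move=> /(ge_inf hl); rewrite -/c; lra.
have dI : ~ I n d.
  move=> /ball_in[e e0 He].
  have : I n (d + e / 2).
    by apply: He; rewrite opprD addNKr normrN gtr0_norm ?divr_gt0//; lra.
  by move=> /(ub_le_sup hu); rewrite -/d; lra.
have Icd : I n = `]c, d[%classic.
  apply/seteqP; split => x /=; rewrite in_itv/=.
    move=> Ix; rewrite !lt_neqAle (ge_inf hl Ix) (ub_le_sup hu Ix) !andbT.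
    apply/andP; split; apply/eqP => E; [by apply: cI; rewrite E|by apply: dI; rewrite -E].
  move=> /andP[cx xd].
  have [y Iy yx] := inf_lt (ex_intro _ z Iz) cx.
  have [w Iw xw] := sup_gt (ex_intro _ z Iz) xd.
  by apply: (iI y w) => //; rewrite (ltW yx) (ltW xw).
have : I n z by [].
rewrite {1}Icd /= in_itv/= => /andP[cz zd].
have cd := lt_trans cz zd.
(* A limit point of [I n] in another component [I m] is impossible: [I m] is open and would meet
   [I n]. *)
have end_out x : (forall e, 0 < e -> exists2 y, `|x - y| < e & I n y) -> ~ I n x -> ~ U x.
  move=> near_x nIx; rewrite UI => -[m _ Imx].
  have [oIm _] := oiI m.
  have /nbhs_ballP[e /= e0 He] := open_nbhs_nbhs (conj oIm Imx).
  have [y xy Iy] := near_x e e0.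
  have Imy : I m y by exact: He.
  have [mn|mn] := eqVneq m n; first by apply: nIx; rewrite -mn.
  have := (proj1 trivIsetP tI) m n Logic.I Logic.I mn.
  by apply/eqP/set0P; exists y.
have ncU : ~ U c.
  apply: end_out => // e e0; pose t := Num.min (e / 2) ((d - c) / 2).
  exists (c + t).
    rewrite opprD addNKr normrN gtr0_norm /t; first by rewrite gt_min; apply/orP; left; lra.
    by rewrite lt_min !divr_gt0 ?subr_gt0.
  rewrite Icd /= in_itv/= ltrDl lt_min !divr_gt0 ?subr_gt0//=.
  by rewrite -ltrBrDl /t gt_min; apply/orP; right; lra.
have ndU : ~ U d.
  apply: end_out => // e e0; pose t := Num.min (e / 2) ((d - c) / 2).
  exists (d - t).
    rewrite opprB addrC subrK gtr0_norm /t; first by rewrite gt_min; apply/orP; left; lra.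
    by rewrite lt_min !divr_gt0 ?subr_gt0.
  rewrite Icd /= in_itv/= ltrBlDr ltrDl lt_min !divr_gt0 ?subr_gt0//= andbT.
  by rewrite ltrBrDl -ltrBrDr /t gt_min; apply/orP; right; lra.
have Hcd : \int[mu]_(y in `[c, d]) k y = 0.
  by apply: H => // y ycd; apply: IU; rewrite Icd /= in_itv.
have mk : measurable_fun setT k by exact: continuous_measurable_fun.
rewrite Icd integral_itv_obnd_cbnd; last by apply/measurable_EFinP; exact: measurable_funTS.
rewrite integral_itv_bndo_bndc; last by apply/measurable_EFinP; exact: measurable_funTS.
by rewrite -[LHS]fineK ?(integrable_fin_num _ (kI c d))// -/(Rintegral _ _ _) Hcd.
Qed.

End plane_measure.

(** * Vanishing of all polynomial moments *)

Section plane.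
Context {R : realType}.
Notation mu := (@lebesgue_measure R).
Variables (h : R * R -> R) (U : set (R * R)) (M : R).
Hypotheses (ch : continuous h) (oU : open U) (M0 : 0 < M).
Hypothesis UM : forall z, U z -> `|z.1| <= M /\ `|z.2| <= M.
Hypothesis ZI : forall a b c d : R, c < d ->
  (forall y, c < y < d -> U (a + b * y, y)) ->
  ~ U (a + b * c, c) -> ~ U (a + b * d, d) ->
  \int[mu]_(y in `[c, d]) h (a + b * y, y) = 0.

Local Notation F := (h \_ U).

Lemma bounded_on_box (P : R * R -> R) (L : R) : continuous P ->
  exists B, forall z, `|z.1| <= L -> `|z.2| <= L -> `|P z| <= B.
Proof.
move=> cP.
have cpt : compact (P @` (`[- L, L]%classic `*` `[- L, L]%classic)).
  apply: continuous_compact; first exact: continuous_subspaceT.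
  by apply: compact_setX; exact: segment_compact.
have [B [_ HB]] := compact_bounded cpt.
exists (B + 1) => z z1 z2; apply: HB; first by rewrite ltrDl.
by exists z => //; split; rewrite /= in_itv/= -ler_norml.
Qed.

Let F0 z : F z != 0 -> `|z.1| <= M /\ `|z.2| <= M.
Proof.
rewrite patchE; case: ifPn => [|_]; last by rewrite eqxx.
by rewrite inE => /UM.
Qed.

Let mF : measurable_fun setT (F : measurableTypeR R * measurableTypeR R -> measurableTypeR R).
Proof.
apply/(measurable_restrictT _ _).1; first exact: open_measurable_prod.
by apply: measurable_funTS; exact: continuous_measurable_prod.
Qed.

Lemma integrable_mul_restrict (P : R * R -> R) : continuous P ->
  (mu \x mu)%E.-integrable setT (EFin \o (fun z => P z * F z)).
Proof.
move=> cP; have [B HB] := @bounded_on_box (fun z => P z * h z) M (fun z => continuousM (@cP z) (@ch z)).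
have B0 : 0 <= B by apply: le_trans (HB (0, 0) _ _); rewrite //= normr0 ltW.
apply: (@integrable_box _ _ B M).
- by apply: measurable_funM => //; exact: continuous_measurable_prod.
- move=> z; have [->|/[dup] Fz /F0[z1 z2]] := eqVneq (F z) 0.
    by rewrite mulr0 normr0.
  apply: le_trans (HB z z1 z2); move: Fz.
  by rewrite patchE; case: ifPn; rewrite ?eqxx.
- by move=> z; rewrite mulf_eq0 negb_or => /andP[_ /F0].
Qed.

Lemma line_integral_eq0 (a b : R) : (\int[mu]_y (F (a + b * y, y)%R)%:E = 0)%E.
Proof.
pose k (y : R) := h (a + b * y, y).
pose V : set R := [set y | U (a + b * y, y)].
have cl : continuous (fun y : R => (a + b * y, y)).
  apply: continuous_pair => y; last exact: cvg_id.
  by apply: cvgD; [exact: cvg_cst|apply: cvgM; [exact: cvg_cst|exact: cvg_id]].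
have oV : open V by exact: ((continuousP _).1 cl U oU).
transitivity (\int[mu]_(y in V) (k y)%:E)%E.
  rewrite [RHS]integral_mkcond; apply: eq_integral => y _.
  rewrite !patchE /V.
  have -> : (y \in [set y0 | U (a + b * y0, y0)]) = ((a + b * y, y) \in U).
    by apply/idP/idP; rewrite !inE.
  by case: ifPn.
apply: (@integral_open_components _ V k M) => //.
- by move=> y /UM[_ /=]; rewrite in_itv/= ler_norml.
- by move=> y; apply: continuous_comp; [exact: cl|exact: ch].
- by move=> c d cd cdV nc nd; exact: ZI.
Qed.

Let Fb : exists B, forall z, `|F z| <= B.
Proof.
have [B HB] := bounded_on_box M ch; exists B => z.
have B0 : 0 <= B by apply: le_trans (HB (0, 0) _ _); rewrite //= normr0 ltW.
have [->|/[dup] Fz /F0[z1 z2]] := eqVneq (F z) 0; first by rewrite normr0.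
apply: le_trans (HB z z1 z2); move: Fz.
by rewrite patchE; case: ifPn; rewrite ?eqxx.
Qed.

(* Fubini in the coordinates [(x - b y, y)], in which lines of slope [b] are
   vertical. *)
Lemma ridge_integral_eq0 (phi : R -> R) (b : R) : continuous phi ->
  (\int[mu \x mu]_z (phi (z.1 - b * z.2) * F z)%:E = 0)%E.
Proof.
move=> cphi.
have cl : continuous (fun z : R * R => z.1 - b * z.2).
  move=> z; apply: cvgB; first exact: cvg_fst.
  by apply: cvgM; [exact: cvg_cst|exact: cvg_snd].
have cphil : continuous (fun z : R * R => phi (z.1 - b * z.2)).
  by move=> z; apply: continuous_comp; [exact: cl|exact: cphi].
have [B HB] := Fb.
have B0 : 0 <= B := le_trans (normr_ge0 _) (HB (0, 0)).
(* Shearing by [b] moves abscissas of the support by at most [|b| * M]. *)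
pose M' := M + `|b| * M.
have MM' : M <= M' by rewrite lerDl mulr_ge0 // ltW.
have [C HC] := @bounded_on_box (fun z => phi z.1) M' (fun z => continuous_comp (@cvg_fst _ _ _ _ _) (@cphi _)).
pose W (z : R * R) := phi z.1 * F (z.1 + b * z.2, z.2).
have csh : continuous (fun z : R * R => z.1 + b * z.2).
  move=> z; apply: cvgD; first exact: cvg_fst.
  by apply: cvgM; [exact: cvg_cst|exact: cvg_snd].
have Wsupp z : F (z.1 + b * z.2, z.2) != 0 -> `|z.1| <= M' /\ `|z.2| <= M'.
  move=> /F0[/= z1 z2]; split; last exact: le_trans z2 MM'.
  have -> : z.1 = (z.1 + b * z.2) - b * z.2 by rewrite addrK.
  apply: le_trans (ler_normB _ _) _; apply: lerD => //.
  by rewrite normrM ler_wpM2l.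
have iW : (mu \x mu)%E.-integrable setT (EFin \o W).
  apply: (@integrable_box _ W (C * B) M').
  - apply: measurable_funM.
      by apply: continuous_measurable_prod => z; apply: continuous_comp; [exact: cvg_fst|exact: cphi].
    apply: (measurableT_comp mF).
    apply: measurable_fun_pair; last exact: measurable_snd.
    exact: continuous_measurable_prod.
  - move=> z; rewrite /W; have [->|/Wsupp[z1 z2]] := eqVneq (F (z.1 + b * z.2, z.2)) 0.
      rewrite mulr0 normr0 mulr_ge0 //.
      by apply: le_trans (HC (0, 0) _ _); rewrite //= normr0 (le_trans _ MM')// ltW.
    by rewrite normrM ler_pM // HC.
  - by move=> z; rewrite mulf_eq0 negb_or => /andP[_ /Wsupp].
rewrite -(integral21_prod_meas1 (integrable_mul_restrict cphil)) /=.
(* On each horizontal line the shear is a translation by [b * y], so translation invariance in one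
   variable replaces a change of variables in the plane. *)
transitivity (\int[mu]_y \int[mu]_x (W (x, y))%:E)%E.
  apply: eq_integral => y _.
  have mg : measurable_fun setT (fun x : R => phi (x - b * y) * F (x, y)).
    apply: measurable_funM.
      apply: continuous_measurable_fun => x; apply: continuous_comp; last exact: cphi.
      by apply: cvgB; [exact: cvg_id|exact: cvg_cst].
    by apply: (measurableT_comp mF); apply: measurable_fun_pair.
  have [C' HC'] := bounded_on_box M cphil.
  have ig : mu.-integrable setT (EFin \o (fun x : R => phi (x - b * y) * F (x, y))).
    apply: (@integrable_segment _ _ (C' * B) M) => // x.
      have [->|/F0[/= z1 z2]] := eqVneq (F (x, y)) 0.
        rewrite mulr0 normr0 mulr_ge0 //.
        by apply: le_trans (HC' (0, 0) _ _); rewrite //= normr0 ltW.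
      by rewrite normrM ler_pM // (HC' (x, y)).
    by rewrite mulf_eq0 negb_or => /andP[_ /F0[]].
  rewrite -[LHS](integral_shift (b * y) mg ig).
  by apply: eq_integral => x _; rewrite /W /= addrK.
rewrite (integral21_prod_meas1 iW) -(integral12_prod_meas1 iW).
apply: integral0_eq => a _; rewrite /W /=.
transitivity (\int[mu]_y ((phi a)%:E * (F (a + b * y, y)%R)%:E))%E.
  by apply: eq_integral => y _ .
rewrite integralZl //; first by rewrite line_integral_eq0 mule0.
apply: (@integrable_segment _ _ B M) => [|y|y] //; last by move=> /F0[].
apply: (measurableT_comp mF); apply: measurable_fun_pair => //.
apply: continuous_measurable_fun => y.
by apply: cvgD; [exact: cvg_cst|apply: cvgM; [exact: cvg_cst|exact: cvg_id]].
Qed.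

Definition pairing (P : R * R -> R) : R := \int[(mu \x mu)%E]_z (P z * F z).

Let pairingZ (c : R) (P : R * R -> R) : continuous P -> pairing (fun z => c * P z) = c * pairing P.
Proof.
move=> cP; rewrite /pairing -RintegralZl //; last exact: integrable_mul_restrict.
by apply: eq_Rintegral => z _; rewrite mulrA.
Qed.

Let pairing_sum n (P : 'I_n -> R * R -> R) : (forall i, continuous (P i)) ->
  pairing (fun z => \sum_i P i z) = \sum_i pairing (P i).
Proof.
elim: n P => [|n IH] P cP.
  rewrite big_ord0 /pairing; under eq_Rintegral do rewrite big_ord0 mul0r.
  by rewrite /Rintegral integral0.
have csum : continuous (fun z => \sum_(i < n) P (widen_ord (leqnSn n) i) z).
  move=> z; apply: cvg_big => [|i _]; last exact: cP.
  exact: add_continuous.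
rewrite big_ord_recr -IH //= /pairing -RintegralD //; [|exact: integrable_mul_restrict..].
by apply: eq_Rintegral => z _; rewrite big_ord_recr /= mulrDl.
Qed.

Lemma continuous_monomial (i j : nat) :
  continuous (fun z : R * R => z.1 ^+ i * z.2 ^+ j).
Proof.
move=> z; apply: cvgM.
  apply: (@cvg_comp _ _ _ fst (fun x : R => x ^+ i)); first exact: cvg_fst.
  exact: exprn_continuous.
apply: (@cvg_comp _ _ _ snd (fun x : R => x ^+ j)); first exact: cvg_snd.
exact: exprn_continuous.
Qed.

(* The vanishing moments against [(x - b y) ^+ k] form a polynomial in [b]. *)
Lemma moment_eq0 (i j : nat) : pairing (fun z => z.1 ^+ i * z.2 ^+ j) = 0.
Proof.
pose k := (i + j)%N.
have cmon := continuous_monomial.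
pose p : {poly R} := \poly_(l < k.+1)
  ((-1) ^+ l * 'C(k, l)%:R * pairing (fun z => z.1 ^+ (k - l) * z.2 ^+ l)).
have p0 b : p.[b] = 0.
  transitivity (pairing (fun z => (z.1 - b * z.2) ^+ k)); last first.
    rewrite /pairing /Rintegral (@ridge_integral_eq0 (fun x => x ^+ k) b) // => x.
    exact: exprn_continuous.
  rewrite horner_poly.
  transitivity (pairing (fun z => \sum_(l < k.+1) ((- b) ^+ l * 'C(k, l)%:R) * (z.1 ^+ (k - l) * z.2 ^+ l))).
    rewrite pairing_sum; last first.
      by move=> l z; apply: cvgM; [exact: cvg_cst|exact: cmon].
    apply: eq_bigr => l _; rewrite pairingZ //.
    by rewrite -[- b]mulN1r exprMn; ring.
  apply: eq_Rintegral => z _; congr (_ * _).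
  rewrite exprDn; apply: eq_bigr => l _.
  by rewrite -mulNr exprMn -mulr_natl; ring.
have : p`_j = 0.
  suff -> : p = 0 by rewrite coef0.
  apply/eqP; apply: contraT => pn0.
  (* A nonzero [p] has fewer than [size p] roots, but the first [size p] natural numbers are all
     roots of [p]. *)
  have := max_poly_roots pn0 (rs := [seq l%:R | l <- iota 0 (size p)]).
  rewrite size_map size_iota ltnn => -> //.
    by apply/allP => x _; apply/rootP; exact: p0.
  by rewrite map_inj_uniq ?iota_uniq//; apply: mulrIn; exact: oner_neq0.
(* The coefficient of [b ^ j] is the moment in question times a sign and the binomial coefficient of
   [i + j] over [j], neither of which is 0. *)
rewrite coef_poly ltnS leq_addl /k addnK => /eqP; rewrite !mulf_eq0.
have -> : ((-1 : R) ^+ j == 0) = false by rewrite signr_eq0.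
by rewrite pnatr_eq0 -leqn0 leqNgt bin_gt0 leq_addl /= => /eqP.
Qed.

Lemma poly_moment_eq0 (p q : {poly R}) : pairing (fun z => p.[z.1] * q.[z.2]) = 0.
Proof.
have cmon := continuous_monomial.
transitivity (pairing (fun z => \sum_(i < size p) \sum_(j < size q)
    (p`_i * q`_j) * (z.1 ^+ i * z.2 ^+ j))).
  apply: eq_Rintegral => z _; congr (_ * _).
  rewrite !horner_coef mulr_suml; apply: eq_bigr => i _.
  by rewrite mulr_sumr; apply: eq_bigr => j _; ring.
have c1 (i j : nat) : continuous (fun z : R * R => (p`_i * q`_j) * (z.1 ^+ i * z.2 ^+ j)).
  by move=> z; apply: cvgM; [exact: cvg_cst|exact: cmon].
rewrite pairing_sum; last first.
  by move=> i z; apply: cvg_big => [|j _]; [exact: add_continuous|exact: c1].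
apply: big1 => i _; rewrite pairing_sum // big1 // => j _.
by rewrite pairingZ // moment_eq0 mulr0.
Qed.

End plane.

(** * Testing against polynomials that peak at the origin *)

Section peak.
Context {R : realType}.
Notation mu := (@lebesgue_measure R).

Definition box (s : R) : set (measurableTypeR R * measurableTypeR R) :=
  `[- s, s]%classic `*` `[- s, s]%classic.

Lemma measurable_box s : measurable (box s).
Proof. by apply: measurableX; exact: measurable_itv. Qed.

Lemma box_measure s : 0 < s -> ((mu \x mu) (box s) = ((2 * s) ^+ 2)%:E)%E.
Proof.
move=> s0.
transitivity (mu `[(- s)%R, s]%classic * mu `[(- s)%R, s]%classic)%E.
  by apply: product_measure1E; exact: measurable_itv.
rewrite [mu _](lebesgue_measure_itv `[- s, s])/= lte_fin ifT; last lra.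
by rewrite -EFinD -EFinM; congr (_%:E); ring.
Qed.

Lemma expr_lt_small (q e : R) : 0 <= q < 1 -> 0 < e -> exists k : nat, q ^+ k < e.
Proof.
move=> /andP[q0 q1] e0.
have /cvgrPdist_lt/(_ e e0)[k _ Hk] : (fun k => q ^+ k) @ \oo --> (0 : R).
  by apply: cvg_expr; rewrite ger0_norm.
exists k; have := Hk k (leqnn k).
by rewrite /= sub0r normrN ger0_norm // exprn_ge0.
Qed.

(* Landau's kernel: [p.[x] * p.[y]] with [p = (1 - 'X^2 / L^2)^k] concentrates at
   the origin as [k] grows. *)
Lemma peak_eq0 (h : R * R -> R) (U : set (R * R)) (M : R) :
  continuous h -> open U -> 0 < M ->
  (forall z, U z -> `|z.1| <= M /\ `|z.2| <= M) ->
  (forall p q : {poly R},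
    (mu \x mu)%E.-integrable setT (EFin \o (fun z => p.[z.1] * q.[z.2] * (h \_ U) z)) /\
    \int[(mu \x mu)%E]_z (p.[z.1] * q.[z.2] * (h \_ U) z) = 0) ->
  U (0, 0) -> h (0, 0) = 0.
Proof.
move=> ch oU M0 UM mom U0; apply/eqP; apply: contraT => a0.
set a := h (0, 0) in a0.
have a2 : 0 < a ^+ 2 by rewrite exprn_even_gt0.
(* Multiplying [h] by its value [a] at the origin makes it positive there whatever the sign of [a];
   near the origin [a * h] exceeds half of [a ^+ 2]. *)
pose kap := a ^+ 2 / 2.
have kap0 : 0 < kap by rewrite divr_gt0.
have [r r0 [rM Hr]] : exists2 r, 0 < r & r <= M /\
    forall z : R * R, `|z.1| < r -> `|z.2| < r -> U z /\ kap <= a * h z.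
  have : \forall z \near (0, 0), U z /\ kap < a * h z.
    apply: filterI; first exact: open_nbhs_nbhs.
    have cah : {for (0, 0), continuous (fun z => a * h z)}.
      by apply: cvgM; [exact: cvg_cst|exact: ch].
    apply: (cvgr_gt _ cah); rewrite -/a -expr2 /kap.
    by rewrite ltr_pdivrMr // ltr_pMr // ltr1n.
  move=> /nbhs_ballP[e /= e0 He].
  exists (Num.min e M); first by rewrite lt_min e0.
  split; first by rewrite ge_min lexx orbT.
  move=> z; rewrite !lt_min => /andP[z1 _] /andP[z2 _].
  have [] := He z; last by move=> ? /ltW.
  by split; rewrite /ball/= sub0r normrN.
have [B HB] := bounded_on_box M ch.
(* On the box of radius [M] the factor [1 - x ^+ 2 / L ^+ 2] is then at least [3 / 4], so the kernel
   is nonnegative wherever [U] has points. *)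
pose L := 2 * M.
have L0 : 0 < L by rewrite mulr_gt0.
(* [rho1] bounds the product of the two factors from below on [box (r / 2)]. Where one coordinate is
   at least [r] in modulus, that factor is at most [rho2] and the other at most 1. With
   [t = r ^+ 2 / L ^+ 2], [rho2 < rho1] says [1 - t < (1 - t / 4) ^+ 2]. *)
pose rho1 := (1 - (r / 2) ^+ 2 / L ^+ 2) ^+ 2.
pose rho2 := 1 - r ^+ 2 / L ^+ 2.
have rL : r ^+ 2 / L ^+ 2 <= 1 / 4.
  rewrite ler_pdivrMr ?exprn_gt0 // /L.
  have : r ^+ 2 <= M ^+ 2 by rewrite !expr2; nra.
  by rewrite exprMn; lra.
have rL0 : 0 < r ^+ 2 / L ^+ 2 by rewrite divr_gt0 // exprn_gt0.
have rho2_0 : 0 < rho2 by rewrite /rho2; lra.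
have rho12 : rho2 < rho1.
  rewrite /rho1 /rho2.
  have -> : (r / 2) ^+ 2 / L ^+ 2 = (r ^+ 2 / L ^+ 2) / 4.
    by field; rewrite gt_eqF.
  move: rL0; set t := r ^+ 2 / L ^+ 2 => t0; nra.
have rho1_0 : 0 < rho1 := lt_trans rho2_0 rho12.
pose B' := `|a| * `|B| + 1.
have B'0 : 0 < B' by rewrite ltr_wpDl // mulr_ge0.
have r2r : r / 2 < r by lra.
have r2M : r / 2 <= M := le_trans (ltW r2r) rM.
(* [a * G] has integral 0 and dominates the step function [low], which is explicit on two boxes of
   areas [r ^+ 2] and [(2 * M) ^+ 2]. The resulting inequality fails for large [k] because the
   powers of [rho2 / rho1] tend to 0. *)
have key k : kap * rho1 ^+ k * r ^+ 2 <= B' * rho2 ^+ k * (2 * M) ^+ 2.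
  pose p : {poly R} := (1 - (L ^- 2)%:P * 'X ^+ 2) ^+ k.
  have pE x : p.[x] = (1 - x ^+ 2 / L ^+ 2) ^+ k.
    by rewrite /p horner_exp !hornerE /= -mulrA -expr2 mulrC.
  have Lsq : 0 < L ^+ 2 by rewrite exprn_gt0.
  have fac_le (x s : R) : 0 <= s -> s <= `|x| -> 1 - x ^+ 2 / L ^+ 2 <= 1 - s ^+ 2 / L ^+ 2.
    move=> s0 sx; rewrite lerD2l lerN2 ler_pM2r ?invr_gt0 //.
    by rewrite -[x ^+ 2]real_normK ?num_real // !expr2; nra.
  have fac_ge (x s : R) : `|x| <= s -> 1 - s ^+ 2 / L ^+ 2 <= 1 - x ^+ 2 / L ^+ 2.
    move=> xs; rewrite lerD2l lerN2 ler_pM2r ?invr_gt0 //.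
    have := normr_ge0 x.
    by rewrite -[x ^+ 2]real_normK ?num_real // !expr2; nra.
  have ML : M ^+ 2 / L ^+ 2 <= 1 / 4.
    by rewrite ler_pdivrMr // /L exprMn; lra.
  have fac0 (x : R) : `|x| <= M -> 0 <= 1 - x ^+ 2 / L ^+ 2.
    by move=> /fac_ge; apply: le_trans; lra.
  have fac1 (x : R) : 1 - x ^+ 2 / L ^+ 2 <= 1.
    by rewrite lerBlDr lerDl divr_ge0 ?sqr_ge0 // ltW.
  have [iG G0] := mom p p.
  pose G z := p.[z.1] * p.[z.2] * (h \_ U) z.
  pose low z := kap * rho1 ^+ k * \1_(box (r / 2)) z - B' * rho2 ^+ k * \1_(box M) z.
  have r20 : 0 < r / 2 by rewrite divr_gt0.
  have iI s c : 0 < s -> (mu \x mu)%E.-integrable setT (EFin \o (fun z => c * \1_(box s) z)).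
    move=> s0; apply: (@integrable_box _ _ `|c| s).
    - apply: measurable_funM => //.
      exact: (measurable_indic (measurable_box s)).
    - move=> z; rewrite indicE; case: (z \in box s); rewrite ?mulr1 ?mulr0 ?normr0 //.
    - move=> z; rewrite indicE; case: (boolP (z \in box s)) => zs /=; last by rewrite mulr0 eqxx.
      by move: zs; rewrite inE => -[/=]; rewrite !in_itv/= -!ler_norml.
  have intI s c : 0 < s -> \int[(mu \x mu)%E]_z (c * \1_(box s) z) = c * (2 * s) ^+ 2.
    move=> s0; rewrite RintegralZl //; last first.
      by have := iI s 1 s0; under eq_fun do rewrite mul1r.
    rewrite /Rintegral integral_indic //; last exact: measurable_box.
    by rewrite setIT; congr (_ * _); exact: (congr1 fine (box_measure s0)).
  have : \int[(mu \x mu)%E]_z low z <= \int[(mu \x mu)%E]_z (a * G z).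
    apply: le_Rintegral => //.
    - exact: (integrableB measurableT (iI _ (kap * rho1 ^+ k) r20) (iI _ (B' * rho2 ^+ k) M0)).
    - exact: (integrableZl measurableT a iG).
    - move=> z _; rewrite /low /G patchE !indicE.
      have [zM|zM] := boolP (z \in box M); last first.
        have /negPf -> : z \notin U.
          apply: contra zM; rewrite !inE => /UM[z1 z2].
          by split; rewrite /= in_itv/= -ler_norml.
        have /negPf -> : z \notin box (r / 2).
          apply: contra zM; rewrite !inE => -[/=]; rewrite !in_itv/= -!ler_norml => z1 z2.
          by split; rewrite /= in_itv/= -ler_norml; [exact: le_trans z1 r2M|exact: le_trans z2 r2M].
        by rewrite !mulr0 subr0.
      move: zM; rewrite inE => -[/=]; rewrite !in_itv/= -!ler_norml => z1M z2M.
      rewrite !pE mulr1.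
      set q1 := (1 - z.1 ^+ 2 / L ^+ 2); set q2 := (1 - z.2 ^+ 2 / L ^+ 2).
      have q10 : 0 <= q1 ^+ k by rewrite exprn_ge0 // fac0.
      have q20 : 0 <= q2 ^+ k by rewrite exprn_ge0 // fac0.
      have q12 : 0 <= q1 ^+ k * q2 ^+ k by rewrite mulr_ge0.
      have Br : 0 <= B' * rho2 ^+ k by rewrite mulr_ge0 ?exprn_ge0 ?ltW.
      have [/andP[z1r z2r]|zr] := boolP ((`|z.1| < r) && (`|z.2| < r)).
        have [Uz hz] := Hr z z1r z2r; rewrite (mem_set Uz).
        have le1 : kap * (q1 ^+ k * q2 ^+ k) <= a * (q1 ^+ k * q2 ^+ k * h z).
          rewrite [leRHS](_ : _ = a * h z * (q1 ^+ k * q2 ^+ k)); last by ring.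
          by rewrite ler_wpM2r.
        apply: le_trans le1; rewrite lerBlDr.
        have [zr2|_] := boolP (z \in box (r / 2)); last first.
          by rewrite mulr0 addr_ge0 // mulr_ge0 // ltW.
        rewrite mulr1 ler_wpDr // ler_wpM2l ?(ltW kap0) //.
        move: zr2; rewrite inE => -[/=]; rewrite !in_itv/= -!ler_norml => z1r2 z2r2.
        have c0 : 0 <= 1 - (r / 2) ^+ 2 / L ^+ 2 by apply: fac0; rewrite ger0_norm ?(ltW r20).
        rewrite /rho1 -exprM mulnC exprM [leLHS]expr2.
        by apply: ler_pM; rewrite ?exprn_ge0 // lerXn2r ?nnegrE // ?fac_ge // fac0.
      have /negPf -> : z \notin box (r / 2).
        apply: contra zr; rewrite inE => -[/=]; rewrite !in_itv/= -!ler_norml => z1 z2.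
        by rewrite (le_lt_trans z1 r2r) (le_lt_trans z2 r2r).
      rewrite mulr0 sub0r lerNl; apply: le_trans (ler_norm _) _.
      set w := if _ then _ else _.
      have wB : `|w| <= `|B|.
        rewrite /w; case: ifP => _; last by rewrite normr0.
        exact: le_trans (HB z z1M z2M) (ler_norm _).
      have qk : q1 ^+ k * q2 ^+ k <= rho2 ^+ k.
        have q1_0 := fac0 _ z1M; have q2_0 := fac0 _ z2M.
        move: zr; rewrite negb_and -!leNgt => /orP[]zr.
          rewrite -[leRHS]mulr1; apply: ler_pM => //; last exact: exprn_ile1 (fac1 _).
          by rewrite lerXn2r ?nnegrE ?(ltW rho2_0) // fac_le // ltW.
        rewrite -[leRHS]mul1r; apply: ler_pM => //; first exact: exprn_ile1 (fac1 _).
        by rewrite lerXn2r ?nnegrE ?(ltW rho2_0) // fac_le // ltW.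
      rewrite normrN !normrM (ger0_norm q10) (ger0_norm q20).
      rewrite [leLHS](_ : _ = `|a| * `|w| * (q1 ^+ k * q2 ^+ k)); last by ring.
      apply: ler_pM => //.
      by rewrite /B' ler_wpDr // ler_wpM2l.
  rewrite RintegralB //; last 2 first.
  - exact: iI.
  - exact: iI.
  rewrite !intI // RintegralZl // [X in a * X]G0 mulr0 subr_le0 => H.
  apply: le_trans H; rewrite le_eqVlt; apply/orP; left; apply/eqP; congr (_ * _ ^+ 2).
  by field.
have q01 : 0 <= rho2 / rho1 < 1.
  by rewrite divr_ge0 ?ltW //= ltr_pdivrMr // mul1r.
have c0 : 0 < kap * r ^+ 2 / (B' * (2 * M) ^+ 2).
  by rewrite divr_gt0 // mulr_gt0 // exprn_gt0.
have [k Hk] := expr_lt_small q01 c0.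
have := key k; rewrite leNgt => /negP[].
move: Hk; rewrite expr_div_n ltr_pdivlMr; last by rewrite mulr_gt0 // exprn_gt0.
rewrite mulrAC ltr_pdivrMr; last exact: (exprn_gt0 k rho1_0).
move=> Hk.
rewrite [ltLHS](_ : _ = rho2 ^+ k * (B' * (2 * M) ^+ 2)); last by ring.
by rewrite [ltRHS](_ : _ = kap * r ^+ 2 * rho1 ^+ k); last by ring.
Qed.
End peak.

(** * Approximation of chords and injectivity of the ray transform *)

Section segment_integral.
Context {R : realType}.
Notation mu := (@lebesgue_measure R).

Lemma continuous_integrable_segment (k : R -> R) (c d : R) : continuous k ->
  mu.-integrable `[c, d]%classic (EFin \o k).
Proof.
move=> ck; apply: continuous_compact_integrable; first exact: segment_compact.
exact: continuous_subspaceT.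
Qed.

Lemma Rintegral_affine (k : R -> R) (c d : R) : continuous k -> c < d ->
  \int[mu]_(y in `[c, d]) k y = (d - c) * \int[mu]_(t in `[0, 1]) k (c + t * (d - c)).
Proof.
move=> ck cd.
pose F t := c + t * (d - c).
have dF (t : R) : is_derive t 1 F (d - c).
  have -> : F = cst c + (d - c) *: id.
    by apply/funext => x; rewrite /F /= !fctE /= [x * _]mulrC.
  rewrite -[X in is_derive _ _ _ X]add0r -[X in is_derive _ _ _ (_ + X)]mulr1.
  exact: (is_deriveD (is_derive_cst c t 1) (is_deriveZ (d - c) (is_derive_id t 1))).
have F'E : derive1 F = cst (d - c).
  by apply/funext => t; rewrite derive1E; have [] := dF t.
have cF : continuous F.
  move=> t; apply: cvgD; first exact: cvg_cst.
  by apply: cvgM; [exact: cvg_id|exact: cvg_cst].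
have ckF : continuous (k \o F) by move=> t; apply: continuous_comp; [exact: cF|exact: ck].
have -> : `[c, d]%classic = `[F 0, F 1]%classic by rewrite /F mul0r addr0 mul1r addrC subrK.
rewrite -RintegralZl //; last exact: continuous_integrable_segment.
rewrite /Rintegral (integration_by_substitution_increasing (F := F)) //.
- congr fine; apply: eq_integral => t _; rewrite F'E /=; congr (_%:E).
  by rewrite mulrC.
- by move=> x y _ _ xy; rewrite /F ltrD2l ltr_pM2r // subr_gt0.
- by rewrite F'E => ? _; exact: cvg_cst.
- by rewrite F'E; exact: is_cvg_cst.
- by rewrite F'E; exact: is_cvg_cst.
- split.
  + by move=> x _; have [] := dF x.
  + exact/cvg_at_right_filter/cF.
  + exact/cvg_at_left_filter/cF.
- exact: continuous_subspaceT.
Qed.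

Lemma Rintegral_segment_small (k l : R -> R) (e : R) : continuous k -> continuous l ->
  (forall t, 0 <= t <= 1 -> `|k t - l t| <= e) ->
  `|\int[mu]_(t in `[0, 1]) k t - \int[mu]_(t in `[0, 1]) l t| <= e.
Proof.
move=> ck cl kl.
have ckl : continuous (fun t => k t - l t) by move=> t; apply: cvgB; [exact: ck|exact: cl].
rewrite -RintegralB //; [|exact: continuous_integrable_segment..].
apply: le_trans (le_normr_Rintegral _ _) _ => //; first exact: continuous_integrable_segment.
have -> : e = \int[mu]_(t in `[0, 1]) e.
  rewrite Rintegral_cst // [X in fine X](lebesgue_measure_itv `[0, 1]) /= lte_fin ltr01.
  by rewrite -EFinD subr0 mulr1.
apply: le_Rintegral => //.
- apply: continuous_integrable_segment => t.
  exact: (@cvg_norm _ _ _ _ _ _ _ (ckl t)).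
- by apply: continuous_integrable_segment => t; exact: cvg_cst.
Qed.

End segment_integral.

Section euclid.
Context {R : realType} {n : nat}.
Implicit Types (u v e : 'rV[R]_n).

Definition dot u v : R := \sum_(k < n) u 0 k * v 0 k.

Lemma enorm_sqr v : enorm v ^+ 2 = dot v v.
Proof.
rewrite /enorm sqr_sqrtr; first by apply: eq_bigr => k _; rewrite expr2.
by apply: sumr_ge0 => k _; exact: sqr_ge0.
Qed.

Lemma dot_comb u v a b : dot (a *: u + b *: v) (a *: u + b *: v) =
  a ^+ 2 * dot u u + 2 * a * b * dot u v + b ^+ 2 * dot v v.
Proof.
rewrite /dot !mulr_sumr -!big_split; apply: eq_bigr => k _ /=.
by rewrite !mxE; ring.
Qed.

Lemma dotZ a b u v : dot (a *: u) (b *: v) = a * b * dot u v.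
Proof. by rewrite /dot mulr_sumr; apply: eq_bigr => k _; rewrite !mxE; ring. Qed.

Lemma enormE v : enorm v = Num.sqrt (dot v v).
Proof. by rewrite -enorm_sqr sqrtr_sqr ger0_norm // sqrtr_ge0. Qed.

Lemma enormZ a v : enorm (a *: v) = `|a| * enorm v.
Proof.
by rewrite !enormE dotZ sqrtrM ?sqr_ge0 // -expr2 sqrtr_sqr.
Qed.

Lemma normr_le_enorm v : `|v| <= enorm v.
Proof.
rewrite [leLHS]mx_normrE; apply/bigmax_leP; split; first exact: sqrtr_ge0.
move=> [i j] _; rewrite ord1 /= -sqrtr_sqr ler_wsqrtr //.
by rewrite (bigD1 j) //= lerDl sumr_ge0 // => k _; exact: sqr_ge0.
Qed.

Lemma enorm_gt0 v : v != 0 -> 0 < enorm v.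
Proof. by rewrite -normr_gt0 => /lt_le_trans; apply; exact: normr_le_enorm. Qed.

Lemma enorm_continuous : continuous (@enorm R n).
Proof.
move=> v; apply: (@continuous_comp _ _ _ (fun w : 'rV[R]_n => \sum_(k < n) w 0 k ^+ 2) Num.sqrt);
  last exact: sqrt_continuous.
apply: (@cvg_big _ _ _ _ _ _ _ (nbhs v) _ (fun k (w : 'rV[R]_n) => w 0 k ^+ 2)) => [|k _].
  exact: add_continuous.
apply: (@cvg_comp _ _ _ (fun w : 'rV[R]_n => w 0 k) (fun x : R => x ^+ 2)); first exact: coord_continuous.
exact: exprn_continuous.
Qed.

(** Rotate the first two coordinates of [v] by a right angle and drop the others; if this gives 0,
    the first unit vector is orthogonal to [v]. *)
Lemma exists_orthogonal v : (2 <= n)%N -> v != 0 -> exists e, enorm e = 1 /\ dot e v = 0.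
Proof.
move=> n2 v0.
suff [w [w0 wv]] : exists w, w != 0 /\ dot w v = 0.
  exists ((enorm w)^-1 *: w); have ew := enorm_gt0 w0; split.
    by rewrite enormZ gtr0_norm ?invr_gt0 // mulVf // gt_eqF.
  by rewrite -[v in dot _ v]scale1r dotZ wv mulr0.
pose i := Ordinal (ltnW n2); pose j := Ordinal n2.
have ij : i != j by [].
pose w : 'rV[R]_n := v 0 j *: delta_mx 0 i - v 0 i *: delta_mx 0 j.
have dotd k u : dot (delta_mx 0 k) u = u 0 k.
  rewrite /dot (bigD1 k) //= mxE !eqxx mul1r big1 ?addr0 // => l lk.
  by rewrite mxE (negPf lk) andbF mul0r.
have dotBl a b x y u : dot (a *: x - b *: y) u = a * dot x u - b * dot y u.
  by rewrite /dot !mulr_sumr -sumrB; apply: eq_bigr => k _; rewrite !mxE; ring.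
have [w0|w0] := eqVneq w 0; last first.
  by exists w; split => //; rewrite dotBl !dotd; ring.
exists (delta_mx 0 i); split.
  by apply/eqP => /rowP/(_ i); rewrite !mxE !eqxx => /eqP; rewrite oner_eq0.
rewrite dotd; have := congr1 (fun u : 'rV[R]_n => u 0 j) w0.
by rewrite !mxE !eqxx eq_sym (negPf ij) mulr0 mulr1 sub0r => /eqP; rewrite oppr_eq0 => /eqP.
Qed.
End euclid.

(** * Chords close to a given one but of a different length *)

Section chords.
Context {R : realType} {n : nat}.
Notation V := ('rV[R]_n).
Implicit Types (O E : set V) (q p : V).

(** Chords are parametrized by their ends over [[0, 1]], so that nearby chords of different lengths
    are compared on one fixed interval. *)
Definition seg q p (t : R) : V := q + t *: (p - q).

Lemma seg_continuous : continuous (fun z : R * (V * V) => seg z.2.1 z.2.2 z.1).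
Proof.
have c2 : continuous (fun z : R * (V * V) => z.2) by move=> z; exact: cvg_snd.
have c21 : continuous (fun z : R * (V * V) => z.2.1).
  by move=> z; apply: (@cvg_comp _ _ _ snd fst); [exact: c2|exact: cvg_fst].
have c22 : continuous (fun z : R * (V * V) => z.2.2).
  by move=> z; apply: (@cvg_comp _ _ _ snd snd); [exact: c2|exact: cvg_snd].
move=> z; apply: cvgD; first exact: c21.
apply: cvgZ; first exact: cvg_fst.
by apply: cvgB; [exact: c22|exact: c21].
Qed.

Lemma seg_tube (P : R * (V * V) -> Prop) q p y1 y2 :
  (forall t, y1 <= t <= y2 -> \forall z \near (t, (q, p)), P z) ->
  exists2 d, 0 < d & forall q' p', `|q - q'| < d -> `|p - p'| < d ->
    forall t, y1 <= t <= y2 -> P (t, (q', p')).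
Proof.
move=> tube.
have /compact_near_coveringP cpt := @segment_compact R y1 y2.
have H := cpt _ (nbhs (q, p)) (fun z t => P (t, z)) (nbhs_filter _).
have : \forall z \near (q, p), forall t, y1 <= t <= y2 -> P (t, z).
  apply: filterS (H _) => [z Hz t tt|t]; first by apply: Hz; rewrite /= in_itv.
  by rewrite /= in_itv/= => /tube; apply: filterS => -[].
move=> /nbhs_ballP[d /= d0 Hd]; exists d => // q' p' qq pp t tt.
by apply: (Hd (q', p')) => //; split; rewrite -ball_normE.
Qed.

Lemma seg_tube_open O q p y1 y2 : open O ->
  (forall t, y1 <= t <= y2 -> O (seg q p t)) ->
  exists2 d, 0 < d & forall q' p', `|q - q'| < d -> `|p - p'| < d ->
    forall t, y1 <= t <= y2 -> O (seg q' p' t).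
Proof.
move=> oO H; apply: (@seg_tube (fun z => O (seg z.2.1 z.2.2 z.1))) => t /H Ot.
exact: (@seg_continuous (t, (q, p)) O (open_nbhs_nbhs (conj oO Ot))).
Qed.

(** A whole ball around [q1] is provided, not just a point of [E] near [q]: it leaves room for
    displacing a line sideways with its end still in [E] and close to [q]. *)
Lemma closure_approx E q d : closure E q -> open E -> 0 < d ->
  exists q1 r, [/\ 0 < r, `|q - q1| < d & forall x, `|q1 - x| < r -> E x /\ `|q - x| < d].
Proof.
move=> Eq oE d0.
have [q1 [Eq1]] := Eq _ (nbhsx_ballx q d d0).
rewrite -ball_normE /= => qq1.
have : \forall x \near q1, E x /\ `|q - x| < d.
  apply: filterI; first exact: open_nbhs_nbhs.
  apply: (@cvgr_norm_lt _ _ _ (nbhs q1) _ (fun x => q - x) (q - q1)) => //.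
  by apply: cvgB; [exact: cvg_cst|exact: cvg_id].
move=> /nbhs_ballP[r /= r0 Hr]; exists q1, r; split => // x xr; apply: Hr.
by rewrite -ball_normE.
Qed.

Lemma seg_frame (z0 v w : V) (a b y L : R) : L != 0 ->
  z0 + (a + b * y) *: w + y *: v =
  seg (z0 - L *: v + (a - b * L) *: w) (z0 + L *: v + (a + b * L) *: w) ((y + L) / (2 * L)).
Proof. by move=> L0; apply/rowP => k; rewrite !mxE; field. Qed.

(* Lines through points of [E] near [q] and [p] contain a chord of [O] with ends
   near [q] and [p]; by [beam_chord_neq] its length can be chosen different
   from that of the given chord. *)
Lemma chord_approx O E q p e : (2 <= n)%N -> open O -> open E ->
  (forall x, O x -> ~ E x) -> closure E q -> closure E p ->
  (forall t, 0 < t < 1 -> O (seg q p t)) -> 0 < e ->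
  exists q' p', [/\ `|q - q'| < e /\ `|p - p'| < e, ~ O q' /\ ~ O p',
    forall t, 0 < t < 1 -> O (seg q' p' t), q' != p' & enorm (p' - q') != enorm (p - q)].
Proof.
move=> n2 oO oE OE Eq Ep Oqp e0.
pose N : R := `|p - q| + 1.
have N0 : 0 < N by rewrite ltr_wpDl.
(* The pieces of the chord with parameter below [eta] or above [1 - eta] have size below [e]. A
   perturbed segment can leave [O] only there, since the compact middle part stays in [O]. *)
pose eta := Num.min (1 / 4) (e / (2 * N)).
have eta0 : 0 < eta by rewrite lt_min; apply/andP; split; [lra|rewrite divr_gt0 // mulr_gt0].
have eta14 : eta <= 1 / 4 by rewrite ge_min lexx.
have etaN : eta * `|p - q| < e.
  apply: le_lt_trans (_ : e / (2 * N) * N < e).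
    by apply: ler_pM; rewrite ?(ltW eta0) // ?ge_min ?lexx ?orbT // lerDl.
  rewrite invfM mulrA divfK ?gt_eqF //; lra.
have [d1 d10 H1] := @seg_tube_open O q p eta (1 - eta) oO (fun t tt => Oqp t ltac:(lra)).
have [d2 d20 H2] : exists2 d, 0 < d & forall q' p', `|q - q'| < d -> `|p - p'| < d ->
    forall t, 0 <= t <= eta -> (ball q e) (seg q' p' t).
  apply: seg_tube_open; first exact: ball_open.
  move=> t /andP[t0 t1]; rewrite -ball_normE /= /seg opprD addNKr normrN normrZ ger0_norm //.
  by apply: le_lt_trans etaN; rewrite ler_wpM2r.
have [d3 d30 H3] : exists2 d, 0 < d & forall q' p', `|q - q'| < d -> `|p - p'| < d ->
    forall t, 1 - eta <= t <= 1 -> (ball p e) (seg q' p' t).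
  apply: seg_tube_open; first exact: ball_open.
  move=> t /andP[t0 t1]; rewrite -ball_normE /= /seg.
  have -> : p - (q + t *: (p - q)) = (1 - t) *: (p - q).
    by rewrite scalerBl scale1r opprD addrA.
  rewrite normrZ ger0_norm; last lra.
  by apply: le_lt_trans etaN; rewrite ler_wpM2r //; lra.
pose d := Num.min d1 (Num.min d2 d3).
have d0 : 0 < d by rewrite !lt_min d10 d20.
have [q1 [rq [rq0 qq1 Hq1]]] := closure_approx Eq oE d0.
have [p1 [rp [rp0 pp1 Hp1]]] := closure_approx Ep oE d0.
have Hd q' p' : `|q - q'| < d -> `|p - p'| < d ->
    [/\ forall t, eta <= t <= 1 - eta -> O (seg q' p' t),
        forall t, 0 <= t <= eta -> `|q - seg q' p' t| < e &
        forall t, 1 - eta <= t <= 1 -> `|p - seg q' p' t| < e].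
  rewrite !lt_min => /and3P[qa qb qc] /and3P[pa pb pc]; split.
  - exact: H1.
  - by move=> t tt; have := H2 _ _ qb pb t tt; rewrite -ball_normE.
  - by move=> t tt; have := H3 _ _ qc pc t tt; rewrite -ball_normE.
(* If [q1 = p1], the perturbed segment is the single point [q1], which would lie both in [O], as its
   middle part, and in [E]. *)
have qp1 : p1 - q1 != 0.
  apply/eqP => E0.
  have [/(_ (1 / 2)) + _ _] := Hd _ _ qq1 pp1.
  rewrite /seg E0 scaler0 addr0 => H; have /OE := H ltac:(lra); apply.
  by have [] := Hq1 q1; rewrite ?subrr ?normr0.
pose ell := enorm (p1 - q1).
have ell0 : 0 < ell := enorm_gt0 qp1.
pose L := ell / 2.
have L0 : 0 < L by rewrite divr_gt0.
pose v := ell^-1 *: (p1 - q1).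
have v1 : enorm v = 1 by rewrite enormZ gtr0_norm ?invr_gt0 // mulVf // gt_eqF.
have v0 : v != 0 by rewrite scaler_eq0 invr_eq0 negb_or gt_eqF.
have [w [w1 wv]] := exists_orthogonal n2 v0.
pose z0 := q1 + L *: v.
have q1E : q1 = z0 - L *: v by rewrite /z0 addrK.
have p1E : p1 = z0 + L *: v.
  have LL : (L + L) * ell^-1 = 1 by rewrite /L; field; rewrite gt_eqF.
  by rewrite /z0 -addrA -scalerDl /v scalerA LL scale1r addrC subrK.
pose Z (z : R * R) := z0 + z.1 *: w + z.2 *: v.
have cZ : continuous Z.
  move=> z; apply: cvgD; last by apply: cvgZ; [exact: cvg_snd|exact: cvg_cst].
  apply: cvgD; first exact: cvg_cst.
  by apply: cvgZ; [exact: cvg_fst|exact: cvg_cst].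
pose D := Z @^-1` O.
have oD : open D by exact: ((continuousP _).1 cZ O oO).
(* Half the smaller radius, so that displacements by at most [alpha] along the unit vector [w] stay
   strictly inside both balls in [E]. *)
pose alpha := Num.min rq rp / 2.
have alpha0 : 0 < alpha by rewrite divr_gt0 // lt_min rq0.
have aw a r : 0 < r -> alpha < r -> `|a| <= alpha -> `|a *: w| < r.
  move=> r0 ar aa; rewrite normrZ; apply: le_lt_trans ar; apply: le_trans aa.
  by rewrite -[leRHS]mulr1 ler_wpM2l // -w1 normr_le_enorm.
have alphaq : alpha < rq.
  by rewrite /alpha ltr_pdivrMr // gt_min; apply/orP; left; lra.
have alphap : alpha < rp.
  by rewrite /alpha ltr_pdivrMr // gt_min; apply/orP; right; lra.
have shift_q a : `|a| <= alpha -> E (q1 + a *: w) /\ `|q - (q1 + a *: w)| < d.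
  by move=> aa; apply: Hq1; rewrite opprD addNKr normrN; exact: aw.
have shift_p a : `|a| <= alpha -> E (p1 + a *: w) /\ `|p - (p1 + a *: w)| < d.
  by move=> aa; apply: Hp1; rewrite opprD addNKr normrN; exact: aw.
have ZE a b y : Z (a + b * y, y) =
    seg (q1 + (a - b * L) *: w) (p1 + (a + b * L) *: w) ((y + L) / (2 * L)).
  by rewrite /Z /= (@seg_frame z0 v w a b y L) ?gt_eqF // -q1E -p1E.
have ends_out a : `|a| <= alpha -> ~ D (a, L) /\ ~ D (a, - L).
  move=> aa; split; rewrite /D /=.
    have -> : Z (a, L) = p1 + a *: w by rewrite /Z /= addrAC -p1E.
    by move/OE; apply; have [] := shift_p a aa.
  have -> : Z (a, - L) = q1 + a *: w by rewrite /Z /= addrAC scaleNr -q1E.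
  by move/OE; apply; have [] := shift_q a aa.
have mid_in a : `|a| <= alpha -> D (a, 0).
  move=> aa; have := ZE a 0 0; rewrite !mul0r addr0 subr0 add0r => Za.
  have [_ qa] := shift_q a aa; have [_ pa] := shift_p a aa.
  have [Hmid _ _] := Hd _ _ qa pa.
  rewrite /D /= Za; apply: Hmid.
  have -> : L / (2 * L) = 1 / 2 by field; rewrite gt_eqF.
  lra.
have [a [b [y1 [y2 [ab [/andP[y1L y10] /andP[y20 y2L]] [nD1 nD2] Din len]]]]] :=
  beam_chord_neq oD L0 alpha0 ends_out mid_in (enorm (p - q)).
have bL : `|b * L| = `|b| * L by rewrite normrM (gtr0_norm L0).
have am : `|a - b * L| <= alpha by apply: le_trans (ler_normB _ _) _; rewrite bL.
have ap : `|a + b * L| <= alpha by apply: le_trans (ler_normD _ _) _; rewrite bL.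
have [_ qa] := shift_q _ am; have [_ pa] := shift_p _ ap.
have [Hmid Hlo Hhi] := Hd _ _ qa pa.
exists (Z (a + b * y1, y1)), (Z (a + b * y2, y2)).
have L2 : 0 < 2 * L by rewrite mulr_gt0.
have diffE : Z (a + b * y2, y2) - Z (a + b * y1, y1) = (y2 - y1) *: (b *: w + v).
  by apply/rowP => k; rewrite /Z /= !mxE; ring.
have lenE : enorm (Z (a + b * y2, y2) - Z (a + b * y1, y1)) = (y2 - y1) * Num.sqrt (1 + b ^+ 2).
  rewrite diffE enormZ ger0_norm; last lra.
  congr (_ * _); rewrite enormE -[v]scale1r dot_comb -!enorm_sqr w1 v1 wv.
  by congr Num.sqrt; ring.
split.
- split.
    rewrite ZE; apply: Hlo; rewrite ler_pdivlMr // ler_pdivrMr // mul0r.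
    apply/andP; split; first lra.
    (* An end beyond the first [eta]-piece would belong to the middle part, which lies in [O],
       whereas ends lie outside it. *)
    rewrite leNgt; apply/negP => lt; apply: nD1; rewrite /D /= ZE; apply: Hmid.
    rewrite ler_pdivlMr // ler_pdivrMr //; apply/andP; split; first exact: ltW.
    nra.
  rewrite ZE; apply: Hhi; rewrite ler_pdivlMr // ler_pdivrMr //.
  apply/andP; split; last lra.
  rewrite leNgt; apply/negP => lt; apply: nD2; rewrite /D /= ZE; apply: Hmid.
  rewrite ler_pdivlMr // ler_pdivrMr //; apply/andP; split; last exact: ltW.
  nra.
- by split.
- move=> t /andP[t0 t1].
  have -> : seg (Z (a + b * y1, y1)) (Z (a + b * y2, y2)) t =
      Z (a + b * (y1 + t * (y2 - y1)), y1 + t * (y2 - y1)).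
    by apply/rowP => k; rewrite /seg /Z /= !mxE; ring.
  by apply: Din; apply/andP; split; nra.
- rewrite eq_sym -subr_eq0 diffE scaler_eq0 negb_or; apply/andP; split.
    by rewrite gt_eqF //; lra.
  apply/eqP => bw0; have : enorm (b *: w + v) = 0 by rewrite bw0 -(scale0r w) enormZ normr0 mul0r.
  rewrite enormE -[v]scale1r dot_comb -!enorm_sqr w1 v1 wv => /eqP.
  by rewrite sqrtr_eq0 leNgt => /negP; apply; have := sqr_ge0 b; nra.
- by rewrite lenE.
Qed.
End chords.

Lemma plane_injective (R : realType) (h : R * R -> R) (U : set (R * R)) (M : R) :
  continuous h -> open U -> 0 < M ->
  (forall z, U z -> `|z.1| <= M /\ `|z.2| <= M) ->
  (forall a b c d : R, c < d ->
    (forall y, c < y < d -> U (a + b * y, y)) ->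
    ~ U (a + b * c, c) -> ~ U (a + b * d, d) ->
    \int[@lebesgue_measure R]_(y in `[c, d]) h (a + b * y, y) = 0) ->
  U (0, 0) -> h (0, 0) = 0.
Proof.
move=> ch oU M0 UM ZI; apply: (@peak_eq0 _ h U M) => // p q; split.
  apply: (integrable_mul_restrict ch oU M0 UM (P := fun z => p.[z.1] * q.[z.2])).
  move=> z; apply: cvgM.
    apply: (@cvg_comp _ _ _ fst (fun x : R => p.[x])); first exact: cvg_fst.
    exact: continuous_horner.
  apply: (@cvg_comp _ _ _ snd (fun x : R => q.[x])); first exact: cvg_snd.
  exact: continuous_horner.
exact: (poly_moment_eq0 ch oU M0 UM ZI).
Qed.

(** * The ray transform with isolated exceptional lengths *)

Section ray.
Context {R : realType} {n : nat}.
Notation V := ('rV[R]_n).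
Notation mu := (@lebesgue_measure R).

Lemma bounded_closure (A : set V) : bounded_set A ->
  exists M : R, 0 < M /\ forall x, closure A x -> `|x| <= M.
Proof.
move=> [M0 [_ HM]]; exists (`|M0| + 2); split; first by rewrite ltr_wpDl.
move=> x Ax; have [y [Ay]] := Ax _ (nbhsx_ballx x 1 ltr01).
rewrite -ball_normE /= => xy.
have yM : `|y| <= `|M0| + 1 by apply: HM => //; rewrite ltr_pwDr // ler_norm.
have := ler_normD (x - y) y; rewrite subrK; lra.
Qed.

(** Tietze's theorem on the compact set [closure A]. For a globally continuous function the integral
    over a segment is defined and continuous in the ends, with no condition on where the segment
    runs. *)
Lemma continuous_extension (A : set V) (f : V -> R) : bounded_set A ->
  {within closure A, continuous f} ->
  exists g : V -> R, continuous g /\ forall x, closure A x -> f x = g x.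
Proof.
move=> bA cf; have [M [M0 AM]] := bounded_closure bA.
have cA : compact (closure A).
  apply: bounded_closed_compact; last exact: closed_closure.
  by exists M; split; [exact: num_real|move=> x Mx y /AM yM; exact: le_trans yM (ltW Mx)].
have [B [_ HB]] := compact_bounded (continuous_compact cf cA).
have [] := @continuous_bounded_extension V R pseudometric_normal (closure A)
  (@closed_closure _ A) f (`|B| + 1) _ cf _.
- by rewrite ltr_wpDl.
- move=> x Ax; apply: HB; last by exists x.
  by rewrite ltr_pwDr // ler_norm.
- by move=> g [fg cg _]; exists g; split => // x Ax; apply: fg; rewrite inE.
Qed.

Definition seg_int (g : V -> R) (q p : V) : R := \int[mu]_(t in `[0, 1]) g (seg q p t).

Lemma seg_continuous1 (q p : V) : continuous (seg q p).
Proof.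
move=> t; apply: cvgD; first exact: cvg_cst.
by apply: cvgZ; [exact: cvg_id|exact: cvg_cst].
Qed.

Lemma seg_int_continuous (g : V -> R) (q p : V) (e : R) : continuous g -> 0 < e ->
  exists2 d, 0 < d & forall q' p', `|q - q'| < d -> `|p - p'| < d ->
    `|seg_int g q p - seg_int g q' p'| <= e.
Proof.
move=> cg e0.
have cseg q1 p1 : continuous (fun t => g (seg q1 p1 t)).
  by move=> t; apply: continuous_comp; [exact: seg_continuous1|exact: cg].
have [d d0 Hd] : exists2 d, 0 < d & forall q' p', `|q - q'| < d -> `|p - p'| < d ->
    forall t, 0 <= t <= 1 -> `|g (seg q p t) - g (seg q' p' t)| < e.
  apply: (@seg_tube _ _ (fun z => `|g (seg q p z.1) - g (seg z.2.1 z.2.2 z.1)| < e)) => t _.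
  pose z0 := (t, (q, p)).
  have c1 : (fun z : R * (V * V) => g (seg q p z.1) - g (seg z.2.1 z.2.2 z.1)) z
      @[z --> z0] --> g (seg q p t) - g (seg q p t).
    apply: cvgB.
      apply: (@cvg_comp _ _ _ fst (fun t => g (seg q p t))); first exact: cvg_fst.
      exact: cseg.
    apply: (@cvg_comp _ _ _ (fun z : R * (V * V) => seg z.2.1 z.2.2 z.1) g).
      exact: seg_continuous.
    exact: cg.
  by apply: (@cvgr_norm_lt _ _ _ (nbhs z0) _ _ _ c1); rewrite subrr normr0.
exists d => // q' p' qq pp; apply: Rintegral_segment_small; [exact: cseg|exact: cseg|].
by move=> t tt; apply: ltW; exact: Hd.
Qed.

Lemma closed_interval_ext (P : set R) : closed P ->
  (forall t, 0 < t < 1 -> P t) -> forall t, 0 <= t <= 1 -> P t.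
Proof.
move=> cP P01 t tt; apply: cP => B /nbhs_ballP[e /= e0 He].
(* [s] is a convex combination of [t] and [1 / 2] with positive weight on [1 / 2], hence in the open
   interval, and within [e / 2] of [t]. *)
pose s := t + Num.min (e / 2) (1 / 2) * (1 - 2 * t).
have m0 : 0 < Num.min (e / 2) (1 / 2) by rewrite lt_min; apply/andP; split; lra.
have m1 : Num.min (e / 2) (1 / 2) <= 1 / 2 by rewrite ge_min lexx orbT.
have m2 : Num.min (e / 2) (1 / 2) <= e / 2 by rewrite ge_min lexx.
exists s; split.
  by apply: P01; rewrite /s; apply/andP; split; nra.
apply: He; rewrite /ball/= /s opprD addNKr normrN normrM gtr0_norm //.
have : `|1 - 2 * t| <= 1 by rewrite ler_norml; lra.
nra.
Qed.

Lemma interior_sub_regular (A : set V) : open A -> A `<=` (closure A)°.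
Proof.
by move=> oA x Ax; apply: filterS (open_nbhs_nbhs (conj oA Ax)); exact: subset_closure.
Qed.

(** The ends are limits of points of the chord, hence in [closure Omega]. They are not in the
    interior of [Omega], which is contained in that of [closure Omega]. So chords of the enlarged
    domain carry data for [Omega]. *)
Lemma boundary_line_seg (Omega : set V) q p : open Omega ->
  ~ (closure Omega)° q -> ~ (closure Omega)° p -> q != p ->
  (forall t, 0 < t < 1 -> (closure Omega)° (seg q p t)) ->
  boundary_line Omega q ((enorm (p - q))^-1 *: (p - q)) (enorm (p - q)).
Proof.
move=> oO nq np qp seg_in; set T := enorm (p - q).
have T0 : 0 < T by apply: enorm_gt0; rewrite subr_eq0 eq_sym.
have lineE t : line q (T^-1 *: (p - q)) t = seg q p (t / T).
  by rewrite /line /seg scalerA.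
have cl t : 0 <= t <= T -> closure Omega (line q (T^-1 *: (p - q)) t).
  move=> /andP[t0 t1]; rewrite lineE.
  apply: (@closed_interval_ext (seg q p @^-1` closure Omega)).
  - by apply: closed_comp => [x _|]; [exact: seg_continuous1|exact: closed_closure].
  - by move=> s /seg_in; exact: interior_subset.
  - by rewrite divr_ge0 ?(ltW T0) //= ler_pdivrMr // mul1r.
have line0 : line q (T^-1 *: (p - q)) 0 = q by rewrite /line scale0r addr0.
have lineT : line q (T^-1 *: (p - q)) T = p.
  by rewrite /line scalerA divff ?gt_eqF // scale1r addrC subrK.
have sub : Omega° `<=` (closure Omega)° by apply: interiorS; exact: subset_closure.
split => //.
- by rewrite enormZ gtr0_norm ?invr_gt0 // mulVf // gt_eqF.
- split; first by apply: cl; rewrite lexx ltW.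
  by rewrite line0; move/sub.
- split; first by apply: cl; rewrite lexx ltW.
  by rewrite lineT; move/sub.
Qed.

(** [X] is the set of exceptional lengths. The length of the given chord may belong to it, but
    lengths close to that one and different from it do not, and [chord_approx] supplies chords of
    such lengths. Continuity of [seg_int] transfers the vanishing. *)
Lemma chord_integral_eq0 (Omega : set V) (g : V -> R) (X : set R) q p :
  (2 <= n)%N -> open Omega -> continuous g ->
  (forall T0, 0 < T0 -> exists2 e, 0 < e &
     forall T, `|T - T0| < e -> T != T0 -> ~ X T) ->
  (forall x0 v T, boundary_line Omega x0 v T -> ~ X T ->
     \int[mu]_(t in `[0, T]) g (line x0 v t) = 0) ->
  ~ (closure Omega)° q -> ~ (closure Omega)° p -> q != p ->
  (forall t, 0 < t < 1 -> (closure Omega)° (seg q p t)) ->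
  seg_int g q p = 0.
Proof.
move=> n2 oO cg iso H nq np qp seg_in.
have T0 : 0 < enorm (p - q) by apply: enorm_gt0; rewrite subr_eq0 eq_sym.
have [e0 e00 He0] := iso _ T0.
apply/eqP; rewrite -normr_eq0 eq_le normr_ge0 andbT.
apply/ler_addgt0Pr => eps eps0; rewrite add0r.
have [d d0 Hd] := seg_int_continuous q p cg eps0.
have [d1 d10 Hd1] : exists2 d, 0 < d & forall q' p', `|q - q'| < d -> `|p - p'| < d ->
    `|enorm (p' - q') - enorm (p - q)| < e0.
  have : \forall z \near (q, p), `|enorm (z.2 - z.1) - enorm (p - q)| < e0.
    have c1 : (fun z : V * V => enorm (z.2 - z.1)) z @[z --> (q, p)] --> enorm (p - q).
      apply: (@cvg_comp _ _ _ (fun z : V * V => z.2 - z.1) (@enorm R n)).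
        by apply: cvgB; [exact: cvg_snd|exact: cvg_fst].
      exact: enorm_continuous.
    apply: (@cvgr_norm_lt _ _ _ (nbhs (q, p)) _ (fun z : V * V => enorm (z.2 - z.1) - enorm (p - q)) 0).
      by rewrite -(subrr (enorm (p - q))); apply: cvgB; [exact: c1|exact: cvg_cst].
    by rewrite normr0.
  move=> /nbhs_ballP[d' /= d'0 Hd']; exists d' => // q' p' qq pp.
  by apply: (Hd' (q', p')); split; rewrite -ball_normE.
(* The complement of an interior is the closure of the complement: this is what replacing [Omega] by
   the interior of its closure provides. *)
have extP x : ~ (closure Omega)° x -> closure (~` closure Omega) x.
  by rewrite closure_setC.
have m0 : 0 < Num.min d d1 by rewrite lt_min d0.
have [q' [p' [[qq pp] [nq' np'] seg_in' qp' len']]] :=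
  @chord_approx _ _ (closure Omega)° (~` closure Omega) q p _ n2 (@open_interior _ _)
    (closed_openC (@closed_closure _ _)) (fun x Ox => fun nx => nx (interior_subset Ox))
    (extP q nq) (extP p np) seg_in m0.
move: qq pp; rewrite !lt_min => /andP[qd qd1] /andP[pd pd1].
have bl := boundary_line_seg oO nq' np' qp' seg_in'.
have nX := He0 _ (Hd1 _ _ qd1 pd1) len'.
have T'0 : 0 < enorm (p' - q') by apply: enorm_gt0; rewrite subr_eq0 eq_sym.
have := H _ _ _ bl nX.
rewrite (@Rintegral_affine _ (fun t => g (line _ _ t))) //; last first.
  move=> t; apply: continuous_comp; last exact: cg.
  apply: cvgD; first exact: cvg_cst.
  by apply: cvgZ; [exact: cvg_id|exact: cvg_cst].
rewrite subr0 => /eqP; rewrite mulf_eq0 gt_eqF //= => /eqP I0.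
have := Hd q' p' qd pd; rewrite {2}/seg_int.
suff -> : \int[mu]_(t in `[0, 1]) g (seg q' p' t) = 0 by rewrite subr0.
rewrite -[RHS]I0; apply: eq_Rintegral => t _.
by rewrite /line /seg add0r scalerA mulfK // gt_eqF.
Qed.

Lemma ray_injective (Omega : set V) (f : V -> R) (X : set R) :
  (2 <= n)%N -> open Omega -> bounded_set Omega ->
  {within closure Omega, continuous f} ->
  (forall T0, 0 < T0 -> exists2 e, 0 < e &
     forall T, `|T - T0| < e -> T != T0 -> ~ X T) ->
  (forall x0 v T, boundary_line Omega x0 v T -> ~ X T ->
     \int[mu]_(t in `[0, T]) f (line x0 v t) = 0) ->
  forall x, Omega x -> f x = 0.
Proof.
move=> n2 oO bO cf iso H x Ox.
have [g [cg fg]] := continuous_extension bO cf.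
have [M [M0 OM]] := bounded_closure bO.
have Hg x0 v T : boundary_line Omega x0 v T -> ~ X T ->
    \int[mu]_(t in `[0, T]) g (line x0 v t) = 0.
  move=> bl nX; rewrite -[RHS](H _ _ _ bl nX); apply: eq_Rintegral => t.
  by rewrite inE /= in_itv/= => tt; rewrite fg //; case: bl => _ _ + _ _; apply.
rewrite fg; last exact: subset_closure.
pose i := Ordinal (ltnW n2); pose j := Ordinal n2.
have ij : (i == j) = false by [].
(* The plane through [x] along the first two coordinate axes, with [x] at the origin. Chords of the
   planar section are chords of the enlarged domain, and they are compared as segments over
   [[0, 1]]. *)
pose Z (z : R * R) : V := x + z.1 *: delta_mx 0 i + z.2 *: delta_mx 0 j.
have cZ : continuous Z.
  move=> z; apply: cvgD; last by apply: cvgZ; [exact: cvg_snd|exact: cvg_cst].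
  apply: cvgD; first exact: cvg_cst.
  by apply: cvgZ; [exact: cvg_fst|exact: cvg_cst].
have Zi z : Z z 0 i = x 0 i + z.1 by rewrite !mxE !eqxx ij andbF mulr0 mulr1 addr0.
have Zj z : Z z 0 j = x 0 j + z.2 by rewrite !mxE !eqxx eq_sym ij andbF mulr0 mulr1 addr0.
have coord_le (u : V) k : `|u 0 k| <= `|u|.
  rewrite [leRHS]mx_normrE; apply: (le_bigmax _ (fun ij : 'I_1 * 'I_n => `|u ij.1 ij.2|) (0, k)).
have x0 : Z (0, 0) = x by rewrite /Z /= !scale0r !addr0.
rewrite -x0; apply: (@plane_injective R (g \o Z) (Z @^-1` (closure Omega)°) (2 * M)).
- by move=> z; apply: continuous_comp; [exact: cZ|exact: cg].
- exact: ((continuousP _).1 cZ _ (@open_interior _ _)).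
- by rewrite mulr_gt0.
- move=> z /interior_subset /OM Zz.
  have xM := OM x (subset_closure Ox).
  have bnd k (s : R) : Z z 0 k = x 0 k + s -> `|s| <= 2 * M.
    move=> E; have -> : s = Z z 0 k - x 0 k by rewrite E addrC addKr.
    apply: le_trans (ler_normB _ _) _.
    have := coord_le (Z z) k; have := coord_le x k; lra.
  by split; [exact: (bnd i)|exact: (bnd j)].
- move=> a b c d cd inU nc nd.
  have ZE y : Z (a + b * y, y) = seg (Z (a + b * c, c)) (Z (a + b * d, d)) ((y - c) / (d - c)).
    by apply/rowP => k; rewrite /Z /seg !mxE /=; field; rewrite subr_eq0 gt_eqF.
  rewrite (@Rintegral_affine _ (fun y => (g \o Z) (a + b * y, y))) //; last first.
    move=> y; apply: (@continuous_comp _ _ _ (fun y => Z (a + b * y, y)) g); last exact: cg.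
    apply: (@continuous_comp _ _ _ (fun y => (a + b * y, y)) Z); last exact: cZ.
    apply: continuous_pair => {}y; last exact: cvg_id.
    by apply: cvgD; [exact: cvg_cst|apply: cvgM; [exact: cvg_cst|exact: cvg_id]].
  rewrite (_ : \int[mu]_(t in `[0, 1]) _ = seg_int g (Z (a + b * c, c)) (Z (a + b * d, d))).
    rewrite (@chord_integral_eq0 Omega g X) ?mulr0 //.
      apply/eqP => /(congr1 (fun u : V => u 0 j)); rewrite !Zj /= => /addrI E.
      by rewrite E ltxx in cd.
    move=> t /andP[t0 t1]; have := ZE (c + t * (d - c)).
    rewrite addrAC subrr add0r mulfK ?subr_eq0 ?gt_eqF // => <-.
    by apply: inU; apply/andP; split; nra.
  apply: eq_Rintegral => t _ /=; rewrite ZE.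
  by rewrite addrAC subrr add0r mulfK ?subr_eq0 ?gt_eqF.
- by rewrite /= x0; exact: interior_sub_regular.
Qed.
End ray.

(** * The matrix-valued problem *)

Section complex_integral.
Context {R : realType} (T : R).
Notation C := R[i].
Notation mu := (@lebesgue_measure R).
Implicit Types f g : R -> C.

Definition cint f : C :=
  (\int[mu]_(t in `[0, T]) complex.Re (f t)) +i* (\int[mu]_(t in `[0, T]) complex.Im (f t)).

Definition cintegrable f : Prop :=
  mu.-integrable `[0, T]%classic (EFin \o (fun t => complex.Re (f t))) /\
  mu.-integrable `[0, T]%classic (EFin \o (fun t => complex.Im (f t))).

Lemma ReD (x y : C) : complex.Re (x + y) = complex.Re x + complex.Re y.
Proof. by case: x => ? ?; case: y. Qed.

Lemma ImD (x y : C) : complex.Im (x + y) = complex.Im x + complex.Im y.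
Proof. by case: x => ? ?; case: y. Qed.

Lemma ReM (x y : C) : complex.Re (x * y) =
  complex.Re x * complex.Re y - complex.Im x * complex.Im y.
Proof. by case: x => ? ?; case: y. Qed.

Lemma ImM (x y : C) : complex.Im (x * y) =
  complex.Re x * complex.Im y + complex.Im x * complex.Re y.
Proof. by case: x => ? ?; case: y. Qed.

Let integrable_lin (u v : R -> R) (a b : R) :
  mu.-integrable `[0, T]%classic (EFin \o u) -> mu.-integrable `[0, T]%classic (EFin \o v) ->
  mu.-integrable `[0, T]%classic (EFin \o (fun t => a * u t + b * v t)) /\
  \int[mu]_(t in `[0, T]) (a * u t + b * v t) =
  a * (\int[mu]_(t in `[0, T]) u t) + b * (\int[mu]_(t in `[0, T]) v t).
Proof.
move=> iu iv; have mI : measurable (`[0, T]%classic : set (measurableTypeR R)) by exact: measurable_itv.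
have iau : mu.-integrable `[0, T]%classic (EFin \o (fun t => a * u t)).
  exact: (integrableZl mI a iu).
have ibv : mu.-integrable `[0, T]%classic (EFin \o (fun t => b * v t)).
  exact: (integrableZl mI b iv).
split; first exact: (integrableD mI iau ibv).
by rewrite RintegralD // !RintegralZl.
Qed.

Lemma cintD f g : cintegrable f -> cintegrable g ->
  cintegrable (fun t => f t + g t) /\ cint (fun t => f t + g t) = cint f + cint g.
Proof.
move=> [fr fi] [gr gi].
have [i1 e1] := integrable_lin 1 1 fr gr; have [i2 e2] := integrable_lin 1 1 fi gi.
have E1 : (fun t => complex.Re (f t + g t)) = (fun t => 1 * complex.Re (f t) + 1 * complex.Re (g t)).
  by apply/funext => t; rewrite ReD !mul1r.
have E2 : (fun t => complex.Im (f t + g t)) = (fun t => 1 * complex.Im (f t) + 1 * complex.Im (g t)).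
  by apply/funext => t; rewrite ImD !mul1r.
split; first by split; rewrite ?E1 ?E2.
by rewrite /cint E1 E2 e1 e2 !mul1r.
Qed.

Lemma cintZ c f : cintegrable f ->
  cintegrable (fun t => c * f t) /\ cint (fun t => c * f t) = c * cint f.
Proof.
move=> [fr fi].
have [i1 e1] := integrable_lin (complex.Re c) (- complex.Im c) fr fi.
have [i2 e2] := integrable_lin (complex.Re c) (complex.Im c) fi fr.
have E1 : (fun t => complex.Re (c * f t)) =
    (fun t => complex.Re c * complex.Re (f t) + - complex.Im c * complex.Im (f t)).
  by apply/funext => t; rewrite ReM mulNr.
have E2 : (fun t => complex.Im (c * f t)) =
    (fun t => complex.Re c * complex.Im (f t) + complex.Im c * complex.Re (f t)).
  by apply/funext => t; rewrite ImM.
split; first by split; rewrite ?E1 ?E2.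
by rewrite /cint E1 E2 e1 e2; case: (c) => a b /=; rewrite mulNr.
Qed.

Lemma cint_sum n (F : 'I_n -> R -> C) : (forall i, cintegrable (F i)) ->
  cintegrable (fun t => \sum_i F i t) /\ cint (fun t => \sum_i F i t) = \sum_i cint (F i).
Proof.
elim: n F => [|n IH] F iF.
  have E : (fun t : R => \sum_(i < 0) F i t) = cst 0 by apply/funext => t; rewrite big_ord0.
  rewrite E big_ord0; split; last by rewrite /cint /= /Rintegral !integral0.
  by split; exact: integrable0.
have [i1 e1] := IH (fun i => F (widen_ord (leqnSn n) i)) (fun i => iF _).
have [i2 e2] := cintD i1 (iF ord_max).
have E : (fun t => \sum_i F i t) =
    (fun t => \sum_(i < n) F (widen_ord (leqnSn n) i) t + F ord_max t).
  by apply/funext => t; rewrite big_ord_recr.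
by rewrite E e2 e1 big_ord_recr.
Qed.
End complex_integral.

Section continuity.
Context {R : realType} {N : nat}.
Notation C := R[i].

Lemma l1_bounded_continuous (psi : 'M[C]_N -> R) (K : R) :
  (forall A B, psi (A - B) = psi A - psi B) ->
  (forall A, `|psi A| <= K * l1norm A) -> continuous psi.
Proof.
move=> psiB psiK A; apply/(@cvgrPdist_lt _ _ _ (nbhs A) (nbhs_filter A)) => e e0.
have K0 : 0 < `|K| + 1 by rewrite ltr_wpDl.
apply: (@filterS _ (nbhs A) (nbhs_filter A) _ _ _ (l1norm_nbhs A (divr_gt0 e0 K0))) => B.
rewrite ltr_pdivlMr // => BA; rewrite distrC -psiB; apply: le_lt_trans (psiK _) _.
apply: le_lt_trans BA; rewrite mulrC ler_wpM2l ?l1norm_ge0 //.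
by rewrite (le_trans (ler_norm K)) // lerDl.
Qed.

Lemma Re_conjm_continuous (P : 'M[C]_N) j l : continuous (fun A => complex.Re (conjm P A j l)).
Proof.
apply: (@l1_bounded_continuous _ (l1norm P * l1norm (invmx P))) => [A B|A].
  by rewrite conjmB; move: (conjm P A) (conjm P B) => X Y; rewrite !mxE; case: (X j l) => ? ?; case: (Y j l).
apply: le_trans (ler_Re_normc _) _; apply: le_trans (normc_le_l1norm _ _ _) _.
by rewrite mulrAC; exact: l1norm_conjm.
Qed.

Lemma Im_conjm_continuous (P : 'M[C]_N) j l : continuous (fun A => complex.Im (conjm P A j l)).
Proof.
apply: (@l1_bounded_continuous _ (l1norm P * l1norm (invmx P))) => [A B|A].
  by rewrite conjmB; move: (conjm P A) (conjm P B) => X Y; rewrite !mxE; case: (X j l) => ? ?; case: (Y j l).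
apply: le_trans (ler_Im_normc _) _; apply: le_trans (normc_le_l1norm _ _ _) _.
by rewrite mulrAC; exact: l1norm_conjm.
Qed.
End continuity.

(** If the cosine is 1 at both [T0 * m] and [T * m], it is 1 at [(T - T0) * m]. The radius
    [pi / |m|] keeps the modulus of this angle below [pi], where the cosine is injective, so the
    angle is 0. *)
Lemma cos_eq1_isolated (R : realType) (m T0 : R) : m != 0 ->
  exists2 e, 0 < e & forall T : R, `|T - T0| < e -> T != T0 -> cos (T * m) != 1.
Proof.
move=> m0; have [c1|c1] := eqVneq (cos (T0 * m)) 1; last first.
  have cc : continuous (fun T : R => cos (T * m)).
    move=> T; apply: (@continuous_comp _ _ _ (fun T : R => T * m) cos); last exact: continuous_cos.
    by apply: cvgM; [exact: cvg_id|exact: cvg_cst].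
  have o1 : open_nbhs (cos (T0 * m)) [set x : R | x != 1] by split => //; exact: open_neq.
  have /nbhs_ballP[e /= e0 He] := cc T0 _ (open_nbhs_nbhs o1).
  by exists e => // T TT _; apply: He; rewrite /ball /= distrC.
have s0 : sin (T0 * m) = 0.
  apply/eqP; rewrite -sqrf_eq0; have := cos2Dsin2 (T0 * m).
  by rewrite c1 expr1n => /eqP; rewrite -subr_eq0 addrAC subrr add0r.
have nm : 0 < `|m| by rewrite normr_gt0.
exists (pi / `|m|); first by rewrite divr_gt0 // pi_gt0.
move=> T TT TT0; apply/eqP => cT.
pose y := (T - T0) * m.
have cy : cos `|y| = 1.
  have : cos y = 1.
    have -> : y = T * m - T0 * m by rewrite /y mulrBl.
    by rewrite cosB c1 s0 cT; ring.
  by case: (ger0P y) => // _; rewrite cosN.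
have ypi : `|y| < pi by rewrite normrM -ltr_pdivlMr.
have := @cos_inj R 0 `|y|; rewrite !in_itv /= lexx pi_ge0 normr_ge0 (ltW ypi) cos0 cy.
move=> /(_ isT isT erefl)/esym/eqP; rewrite normr_eq0 /y mulf_eq0 (negPf m0) orbF subr_eq0.
by rewrite (negPf TT0).
Qed.

Section reduction.
Context {R : realType} {n N : nat}.
Notation C := R[i].
Notation V := ('rV[R]_n).
Notation mu := (@lebesgue_measure R).
Variables (Omega : set V) (bO : bounded_set Omega).
Implicit Types (H : V -> 'M[C]_N) (P : 'M[C]_N).

Lemma line_integrable (f : V -> R) x0 v T : {within closure Omega, continuous f} ->
  boundary_line Omega x0 v T ->
  mu.-integrable `[0, T]%classic (EFin \o (fun t => f (line x0 v t))).
Proof.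
move=> cf [_ _ inO _ _]; have [g [cg fg]] := continuous_extension bO cf.
have cgl : continuous (fun t => g (line x0 v t)).
  move=> t; apply: continuous_comp; last exact: cg.
  apply: cvgD; first exact: cvg_cst.
  by apply: cvgZ; [exact: cvg_id|exact: cvg_cst].
apply: (eq_integrable _ _ _ _ (continuous_integrable_segment 0 T cgl)) => // t.
by rewrite inE /= in_itv/= => tt; rewrite fg //; exact: inO.
Qed.

Lemma Re_conjm_within H P j l : {within closure Omega, continuous H} ->
  {within closure Omega, continuous (fun x => complex.Re (conjm P (H x) j l))}.
Proof.
move=> cH x; apply: (@continuous_comp _ _ _ (H : subspace (closure Omega) -> 'M[C]_N)
  (fun A => complex.Re (conjm P A j l))); [exact: cH|exact: Re_conjm_continuous].
Qed.

Lemma Im_conjm_within H P j l : {within closure Omega, continuous H} ->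
  {within closure Omega, continuous (fun x => complex.Im (conjm P (H x) j l))}.
Proof.
move=> cH x; apply: (@continuous_comp _ _ _ (H : subspace (closure Omega) -> 'M[C]_N)
  (fun A => complex.Im (conjm P A j l))); [exact: cH|exact: Im_conjm_continuous].
Qed.

Lemma conjm_entry_cintegrable H P j l x0 v T : {within closure Omega, continuous H} ->
  boundary_line Omega x0 v T ->
  cintegrable T (fun t => conjm P (H (line x0 v t)) j l).
Proof.
move=> cH bl; split.
  apply: (line_integrable (f := fun x => complex.Re (conjm P (H x) j l))) bl.
  exact: Re_conjm_within.
apply: (line_integrable (f := fun x => complex.Im (conjm P (H x) j l))) bl.
exact: Im_conjm_within.
Qed.

Lemma conjm_entryE P (A : 'M[C]_N) j l :
  conjm P A j l = \sum_k \sum_m (P j m * invmx P k l) * A m k.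
Proof.
rewrite /conjm mxE; apply: eq_bigr => k _; rewrite mxE mulr_suml.
by apply: eq_bigr => m _; ring.
Qed.

Lemma conjm1 (A : 'M[C]_N) : conjm 1%:M A = A.
Proof. by rewrite /conjm invmx1 mulmx1 mul1mx. Qed.

(** Entries in the eigenbasis are linear combinations, with constant coefficients, of the original
    entries, so integration along a line commutes with the change of basis. *)
Lemma conjm_line_integral H P j l x0 v T : {within closure Omega, continuous H} ->
  boundary_line Omega x0 v T ->
  conjm P (line_integral H x0 v T) j l = cint T (fun t => conjm P (H (line x0 v t)) j l).
Proof.
move=> cH bl.
have iH m k : cintegrable T (fun t => H (line x0 v t) m k).
  by have := conjm_entry_cintegrable 1%:M m k cH bl; under eq_fun do rewrite conjm1.
have iZ m k c := (cintZ c (iH m k)).1.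
have iS k := (cint_sum (fun m => iZ m k (P j m * invmx P k l))).
have iSS := cint_sum (fun k => (iS k).1).
under [in RHS]eq_fun do rewrite conjm_entryE.
rewrite iSS.2 conjm_entryE; apply: eq_bigr => k _; rewrite (iS k).2.
apply: eq_bigr => m _; rewrite (cintZ _ (iH m k)).2; congr (_ * _).
by rewrite /line_integral mxE.
Qed.
End reduction.

Lemma ray_injective_complex (R : realType) (n : nat) (Omega : set 'rV[R]_n)
    (f : 'rV[R]_n -> R[i]) (X : set R) : (2 <= n)%N -> open Omega -> bounded_set Omega ->
  {within closure Omega, continuous (fun x => complex.Re (f x))} ->
  {within closure Omega, continuous (fun x => complex.Im (f x))} ->
  (forall T0, 0 < T0 -> exists2 e, 0 < e &
     forall T, `|T - T0| < e -> T != T0 -> ~ X T) ->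
  (forall x0 v T, boundary_line Omega x0 v T -> ~ X T ->
     cint T (fun t => f (line x0 v t)) = 0) ->
  forall x, Omega x -> f x = 0.
Proof.
move=> n2 oO bO cRe cIm iso H x Ox.
have r0 : complex.Re (f x) = 0.
  apply: (ray_injective (f := fun x => complex.Re (f x)) n2 oO bO cRe iso _ Ox).
  by move=> x0 v T bl nX; have [] := H x0 v T bl nX.
have i0 : complex.Im (f x) = 0.
  apply: (ray_injective (f := fun x => complex.Im (f x)) n2 oO bO cIm iso _ Ox).
  by move=> x0 v T bl nX; have [] := H x0 v T bl nX.
by apply/eqP; rewrite eq_complex r0 i0 !eqxx.
Qed.

Theorem theorem6p13 (R : realType) (n N : nat) (n_ge2 : (2 <= n)%N)
    (Omega : set 'rV[R]_n)
    (Omega_nonempty : Omega !=set0) (Omega_open : open Omega)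
    (Omega_connected : connected Omega) (Omega_bounded : bounded_set Omega)
    (H0 : 'M[R[i]]_N) (H0_herm : H0 \is hermsymmx)
    (H H' : 'rV[R]_n -> 'M[R[i]]_N)
    (H_cont : {within closure Omega, continuous H})
    (H'_cont : {within closure Omega, continuous H'})
    (H_herm : forall x, closure Omega x -> H x \is hermsymmx)
    (H'_herm : forall x, closure Omega x -> H' x \is hermsymmx)
    (same_data : forall (x0 v : 'rV[R]_n) (T : R), boundary_line Omega x0 v T ->
       exists c : R[i],
         line_data H0 H x0 v T - line_data H0 H' x0 v T = c%:M) :
  forall x, Omega x -> trace_free (H x) = trace_free (H' x).
Proof.
move=> x Ox.
have [P [lam [Pu PH0]]] := hermitian_diagonalization H0_herm.
pose h j l y : R[i] := conjm P (H y) j l - conjm P (H' y) j l.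
have ReB (a b : R[i]) : complex.Re (a - b) = complex.Re a - complex.Re b by case: a; case: b.
have ImB (a b : R[i]) : complex.Im (a - b) = complex.Im a - complex.Im b by case: a; case: b.
have hRe j l : {within closure Omega, continuous (fun y => complex.Re (h j l y))}.
  under eq_fun do rewrite ReB.
  by move=> y; apply: cvgB; exact: Re_conjm_within.
have hIm j l : {within closure Omega, continuous (fun y => complex.Im (h j l y))}.
  under eq_fun do rewrite ImB.
  by move=> y; apply: cvgB; exact: Im_conjm_within.
have hint j l x0 v T : boundary_line Omega x0 v T ->
    cintegrable T (fun t => h j l (line x0 v t)) /\
    cint T (fun t => h j l (line x0 v t)) =
    conjm P (line_integral H x0 v T - line_integral H' x0 v T) j l.
  move=> bl.
  have i1 := conjm_entry_cintegrable Omega_bounded P j l H_cont bl.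
  have i2 := conjm_entry_cintegrable Omega_bounded P j l H'_cont bl.
  have [i2N e2N] := cintZ (-1) i2; have [i12 e12] := cintD i1 i2N.
  have E : (fun t => h j l (line x0 v t)) = (fun t => conjm P (H (line x0 v t)) j l +
      -1 * conjm P (H' (line x0 v t)) j l) by apply/funext => t; rewrite mulN1r.
  split; first by rewrite E.
  rewrite E e12 e2N mulN1r conjmB.
  rewrite -(conjm_line_integral Omega_bounded P j l H_cont bl).
  rewrite -(conjm_line_integral Omega_bounded P j l H'_cont bl).
  by move: (conjm P _) (conjm P _) => Y Z; rewrite !mxE.
have entries x0 v T (bl : boundary_line Omega x0 v T) :
    (forall j l, j != l -> lam j = lam l \/ cos (T * (lam j - lam l)) != 1 ->
      cint T (fun t => h j l (line x0 v t)) = 0) /\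
    (forall j l, cint T (fun t => h j j (line x0 v t)) = cint T (fun t => h l l (line x0 v t))).
  have [c dc] := same_data _ _ _ bl.
  have [e1 e2] := line_data_entries Pu PH0 dc.
  split=> [j l jl|j l]; rewrite !(hint _ _ _ _ _ bl).2; [exact: e1|exact: e2].
have off j l : j != l -> h j l x = 0.
  move=> jl.
  (* The exceptional lengths depend on the entry: [X] holds those at which the multiplier of the
     [(j, l)] entry vanishes, and it is empty for equal eigenvalues. *)
  apply: (ray_injective_complex (X := [set T | lam j != lam l /\ cos (T * (lam j - lam l)) = 1])
    n_ge2 Omega_open Omega_bounded (hRe j l) (hIm j l) _ _ Ox).
    move=> T0 _; have [E|E] := eqVneq (lam j) (lam l).
      by exists 1 => // T _ _ [].
    have m0 : lam j - lam l != 0 by rewrite subr_eq0.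
    have [e e0 He] := cos_eq1_isolated T0 m0.
    by exists e => // T T1 T2 [_ /eqP]; apply/negP; exact: He.
  move=> x0 v T bl nX; apply: (entries _ _ _ bl).1 => //.
  have [E|E] := eqVneq (lam j) (lam l); first by left.
  by right; apply/eqP => c1; apply: nX.
have dia j l : h j j x - h l l x = 0.
  have hd x0 v T : boundary_line Omega x0 v T ->
      cint T (fun t => h j j (line x0 v t) - h l l (line x0 v t)) = 0.
    move=> bl; have [i1 e1] := hint j j _ _ _ bl; have [i2 e2] := hint l l _ _ _ bl.
    have [i2N e2N] := cintZ (-1) i2; have [_ e12] := cintD i1 i2N.
    under eq_fun do rewrite -mulN1r.
    by rewrite e12 e2N mulN1r (proj2 (entries _ _ _ bl) j l) subrr.
  (* Only differences of diagonal entries are free of the unknown scalar. They are known on every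
     chord, so there are no exceptional lengths. *)
  apply: (ray_injective_complex (f := fun y => h j j y - h l l y) (X := set0)
    n_ge2 Omega_open Omega_bounded _ _ _ _ Ox).
  - by under eq_fun do rewrite ReB; move=> y; apply: cvgB; exact: hRe.
  - by under eq_fun do rewrite ImB; move=> y; apply: cvgB; exact: hIm.
  - by move=> T0 _; exists 1 => // ? _ _ [].
  - by move=> x0 v T bl _; exact: hd.
(* Without an index, that is for [N = 0], there is nothing to compare; otherwise [N] is invertible,
   as the normalization of the trace requires. *)
have [j0 _|noj] := pickP (@predT 'I_N); last first.
  by apply/matrixP => j; have := noj j.
(* In the eigenbasis the difference is diagonal with equal entries. Such a scalar matrix is the same
   in every basis, and [trace_free] removes it. *)
have Hc : H x - H' x = (h j0 j0 x)%:M.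
  apply: (conjm_inj_scalar Pu); apply/matrixP => j l.
  have -> : conjm P (H x - H' x) j l = h j l x.
    by rewrite conjmB /h; move: (conjm P (H x)) (conjm P (H' x)) => Y Z; rewrite !mxE.
  rewrite mxE; case: eqVneq => [<-|jl]; last exact: off.
  by rewrite mulr1n; apply/subr0_eq; exact: dia.
have N0 : (N%:R : R[i]) != 0.
  by rewrite pnatr_eq0 -lt0n; apply: leq_ltn_trans (ltn_ord j0).
move: (h j0 j0 x) Hc => c Hc.
rewrite /trace_free -[H x](subrK (H' x)) Hc mxtraceD mxtrace_scalar.
have sD (a b : R[i]) : (a + b)%:M = a%:M + b%:M :> 'M[R[i]]_N.
  by apply/matrixP => j l; rewrite !mxE mulrnDl.
rewrite mulrDr -[c *+ N]mulr_natl mulKf // sD opprD.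
by rewrite addrACA subrr add0r.
Qed.
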